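(* Let $n\ge 1$ and $\rho>1$, and let $E_\rho\subset\mathbb C$ be the open Bernstein ellipse (foci $\pm1$, semi-major plus semi-minor axis equal to $\rho$) with closure $\bar E_\rho$ and boundary $\partial E_\rho$. Let $A:\bar E_\rho\to\mathbb C^{n\times n}$ and $\boldsymbol b:\bar E_\rho\to\mathbb C^n$ be continuous on $\bar E_\rho$ and analytic on $E_\rho$, with $A(t)$ invertible for every $t\in\bar E_\rho$. Put $\boldsymbol x(t)=A(t)^{-1}\boldsymbol b(t)$ and $\kappa_\rho:=\max_{t\in\partial E_\rho}\|\boldsymbol x(t)\|_2$. Let $M\ge 2$, $\Delta t=2/(M-1)$, and consider the equispaced times $t_{i-M}=-1,\ t_{i-M+1}=-1+\Delta t,\ \dots,\ t_{i-1}=1$, and the next time $t_i=1+\Delta t$. Let $X=[\boldsymbol x(t_{i-M})\,|\,\cdots\,|\,\boldsymbol x(t_{i-1})]\in\mathbb C^{n\times M}$, $\mathcal S=\mathrm{span}(X)$, and let $$\boldsymbol s^*\in\operatorname{argmin}_{\boldsymbol s\in\mathcal S}\|A(t_i)\boldsymbol s-\boldsymbol b(t_i)\|_2.$$ Set $r=(t_i+\sqrt{t_i^2-1})/\rho$ and assume $r<1$. Then for every nonnegative integer $R\le\frac12\sqrt{M-1}$, $$\|A(t_i)\boldsymbol s^*-\boldsymbol b(t_i)\|_2\le 2\|A(t_i)\|_2\,\kappa_\rho\Big[\frac{1}{1-r}+\frac{C(M,R)\,\rho}{(\rho-1)\sqrt{\rho^2r^2-1}}\Big]r^{R+1},$$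 where $C(M,R)=5\sqrt5\,\sqrt{2R+1}\,\sqrt M/\sqrt{2(M-1)}$.
   Context: $\|\cdot\|_2$ denotes the Euclidean norm for vectors and the spectral norm for matrices. The vector $\boldsymbol s^*$ is the initial guess produced by minimizing the residual of the linear system at time $t_i$ over the span of the $M$ previous solutions. *)

(* Defs.v *)
From HB Require Import structures.
From mathcomp Require Import all_boot all_order all_algebra.
From mathcomp Require Export complex.
From mathcomp Require Export all_classical all_reals all_analysis.
Export Order.TTheory GRing.Theory Num.Theory.
Export numFieldNormedType.Exports.

Set Implicit Arguments.
Unset Strict Implicit.
Unset Printing Implicit Defensive.

Local Open Scope ring_scope.
Local Open Scope classical_set_scope.

(* Equip R[i] with its standard (modulus) topology / normed structure over
   itself, copied from the regular alias R[i]^o. With these instances,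
   [derivable f z 1] for f : R[i] -> V is complex (holomorphic)
   differentiability at z. *)
HB.instance Definition _ (R : rcfType) := GRing.ComAlgebra.copy R[i] (R[i])^o.
HB.instance Definition _ (R : rcfType) := NormedModule.copy R[i] (R[i])^o.

Definition vnorm (R : rcfType) (n : nat) (v : 'cV[R[i]]_n) : R :=
  Num.sqrt (\sum_(k < n) ((complex.Re (v k ord0)) ^+ 2 + (complex.Im (v k ord0)) ^+ 2)).

Definition specnorm (R : realType) (m n : nat) (A : 'M[R[i]]_(m, n)) : R :=
  sup [set vnorm (A *m v) | v in [set v : 'cV[R[i]]_n | vnorm v <= 1]].

(* Bernstein ellipse with foci -1, 1 and semi-axes a + b = rho:
   a = (rho + 1/rho)/2, b = (rho - 1/rho)/2. *)
Definition bern_a (R : rcfType) (rho : R) : R := (rho + rho^-1) / 2.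
Definition bern_b (R : rcfType) (rho : R) : R := (rho - rho^-1) / 2.
Definition bern_q (R : rcfType) (rho : R) (z : R[i]) : R :=
  (complex.Re z) ^+ 2 / (bern_a rho) ^+ 2 + (complex.Im z) ^+ 2 / (bern_b rho) ^+ 2.
Definition bern_open (R : rcfType) (rho : R) : set R[i] :=
  [set z | bern_q rho z < 1].
Definition bern_closed (R : rcfType) (rho : R) : set R[i] :=
  [set z | bern_q rho z <= 1].
Definition bern_boundary (R : rcfType) (rho : R) : set R[i] :=
  [set z | bern_q rho z = 1].

Definition cplx (R : rcfType) (x : R) : R[i] := Complex x 0.

Definition solx (R : rcfType) (n : nat) (A : R[i] -> 'M[R[i]]_n)
  (b : R[i] -> 'cV[R[i]]_n) (t : R[i]) : 'cV[R[i]]_n :=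
  invmx (A t) *m b t.

(* kappa_rho = max over the boundary of ||x(t)||_2 (attained, so = sup) *)
Definition kappa (R : realType) (n : nat) (A : R[i] -> 'M[R[i]]_n)
  (b : R[i] -> 'cV[R[i]]_n) (rho : R) : R :=
  sup [set vnorm (solx A b t) | t in bern_boundary rho].

Definition dt (R : rcfType) (M : nat) : R := 2 / (M%:R - 1).
(* j-th snapshot time t_{i-M+j} = -1 + j Delta t, j = 0..M-1 *)
Definition tpast (R : rcfType) (M : nat) (j : nat) : R := -1 + j%:R * dt R M.
Definition tnext (R : rcfType) (M : nat) : R := 1 + dt R M.

Definition snapX (R : rcfType) (n M : nat) (A : R[i] -> 'M[R[i]]_n)
  (b : R[i] -> 'cV[R[i]]_n) : 'M[R[i]]_(n, M) :=
  \matrix_(k < n, j < M) solx A b (cplx (tpast R M j)) k ord0.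

Definition CMR (R : rcfType) (M Rk : nat) : R :=
  5 * Num.sqrt 5 * Num.sqrt (2 * Rk%:R + 1) * Num.sqrt M%:R
    / Num.sqrt (2 * (M%:R - 1)).

(* Main.v *)
(* The residual at t_i is A(t_i) times the error of approximating x(t_i) by some
   combination of the snapshots, so it suffices to exhibit good coefficients c_j.

   Coefficients.  Round the Chebyshev extrema cos(j pi/R), 0 <= j <= R, to the
   time grid and take for c_j the Lagrange weights at t_i of the rounded nodes
   y_j.  Since |T_R'| <= R^2 on [-1, 1] and R^2 dt <= 1/2, the sign alternation
   (-1)^j T_R(y_j) >= 1/2 survives the rounding; the Lagrange weights alternate
   in sign too, so sum_j |c_j| <= 2 T_R(t_i) <= 2 (rho r)^R.  This l^1 bound is
   well below what the constant C(M,R) allows.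

   Error.  With z = (v + 1/v)/2, q = v/u and p = 1/(uv), the Joukowski form of
   Cauchy's formula writes f(z) as the mean over |u| = rho of
   f((u + 1/u)/2) K_z(u), where
     K_z(u) = 1/(1-q) + 1/(1-p) - 1 = 1 + 2 sum_{k >= 1} u^-k T_k(z).
   The functional f |-> f(t_i) - sum_j c_j f(t_j) kills T_0, ..., T_R, so only
   the geometric tails of K_z contribute.

   Cauchy's formula is obtained without integrals: integrals are replaced by
   left Riemann sums on 2^n points, for which the subdivision of a rectangle
   into four is exact, and affine functions have contour sum exactly zero;
   Goursat's bisection argument then makes the contour sums tend to zero. *)
Require Import Defs.
From HB Require Import structures.
From mathcomp Require Import all_boot all_order all_algebra.
From mathcomp Require Import complex qpoly zify ring lra.
From mathcomp Require Import all_classical all_reals all_analysis.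
Import Order.TTheory GRing.Theory Num.Theory.
Import numFieldNormedType.Exports.
Set Implicit Arguments.
Unset Strict Implicit.
Unset Printing Implicit Defensive.
Local Open Scope ring_scope.
Local Open Scope classical_set_scope.

(** * Complex differentiation rules for pointwise-defined functions *)

Section ComplexCalculus.
Variable R : realType.
Local Notation C := R[i].
Implicit Types (f g : C -> C) (z w : C).

Lemma derivable_coord m n (A : C -> 'M[C]_(m, n)) z i j :
  derivable A z 1 -> derivable (fun w => A w i j) z 1.
Proof.
move=> /cvg_ex[/= l hl]; apply/cvg_ex; exists (l i j).
have /(cvg_comp _ _ hl) := @coord_continuous C _ _ i j l.
by apply: cvg_trans; apply: near_eq_cvg; near=> h; rewrite /= !mxE.
Unshelve. all: by end_near.
Qed.

Lemma derivableC_cst (c : C) z : derivable (fun=> c : C) z 1.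
Proof. by have := @derivable_cst C C C c z 1. Qed.

Lemma derivableC_id z : derivable (fun w : C => w) z 1.
Proof. by have := @derivable_id C C z 1. Qed.

Lemma derivableC_add f g z : derivable f z 1 -> derivable g z 1 ->
  derivable (fun w => f w + g w) z 1.
Proof. by move=> hf hg; have := @derivableD C C C f g z 1 hf hg. Qed.

Lemma derivableC_mul f g z : derivable f z 1 -> derivable g z 1 ->
  derivable (fun w => f w * g w) z 1.
Proof. by move=> hf hg; have := @derivableM C C f g z 1 hf hg. Qed.

Lemma derivableC_inv f z : f z != 0 -> derivable f z 1 ->
  derivable (fun w => (f w)^-1) z 1.
Proof. by move=> hz hf; have := @derivableV C C f z 1 hz hf. Qed.

Lemma derivableC_comp f g z : derivable f (g z) 1 -> derivable g z 1 ->
  derivable (fun w => f (g w)) z 1.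
Proof.
move=> /(@derivable1_diffP C C f (g z)).1 hf /(@derivable1_diffP C C g z).1 hg.
apply/(@derivable1_diffP C C (fun w => f (g w)) z).2.
exact: (@differentiable_comp C C C C g f z hg hf).
Qed.

Lemma derivableC_near_eq f g z : (\forall w \near z, f w = g w) -> derivable f z 1 ->
  derivable g z 1.
Proof. by move=> h; exact: (@near_eq_derivable C C C f g z 1 h). Qed.

End ComplexCalculus.

(** * The real-valued modulus on complex numbers *)

Section Modulus.
Variable R : rcfType.
Local Notation C := R[i].
Local Notation nc := (@ComplexField.Normc.normc R).
Implicit Types (z w : C).

Lemma ncE z : `|z| = (nc z)%:C%C.
Proof. by case: z. Qed.

Lemma nc_ge0 z : 0 <= nc z.
Proof. by case: z => a b /=; exact: sqrtr_ge0. Qed.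

Lemma ncD z w : nc (z + w) <= nc z + nc w.
Proof. exact: le_normcD. Qed.

Lemma ncN z : nc (- z) = nc z.
Proof. exact: normcN. Qed.

Lemma ncB z w : nc (z - w) <= nc z + nc w.
Proof. by rewrite -(ncN w) ncD. Qed.

Lemma ncBC z w : nc (z - w) = nc (w - z).
Proof. by rewrite -ncN opprB. Qed.

Lemma ncM z w : nc (z * w) = nc z * nc w.
Proof. exact: ComplexField.Normc.normcM. Qed.

Lemma ncV z : nc z^-1 = (nc z)^-1.
Proof. exact: ComplexField.Normc.normcV. Qed.

Lemma nc0 : nc 0 = 0.
Proof. exact: ComplexField.Normc.normc0. Qed.

Lemma nc1 : nc 1 = 1.
Proof. exact: ComplexField.Normc.normc1. Qed.

Lemma nc_eq0 z : (nc z == 0) = (z == 0).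
Proof.
by apply/eqP/eqP => [/ComplexField.Normc.eq0_normc//|->]; exact: nc0.
Qed.

Lemma nc_gt0 z : (0 < nc z) = (z != 0).
Proof. by rewrite lt_def nc_eq0 nc_ge0 andbT. Qed.

Lemma ncX z k : nc (z ^+ k) = nc z ^+ k.
Proof. by elim: k => [|k ih]; rewrite ?expr0 ?nc1// !exprS ncM ih. Qed.

Lemma nc_sum (I : Type) (s : seq I) (P : pred I) (F : I -> C) :
  nc (\sum_(i <- s | P i) F i) <= \sum_(i <- s | P i) nc (F i).
Proof.
elim/big_ind2: _ => [|x a y b hx hy|//]; first by rewrite nc0.
by rewrite (le_trans (ncD _ _))// lerD.
Qed.

Lemma nc_real (x : R) : nc x%:C%C = `|x|.
Proof. by rewrite /= expr0n addr0 sqrtr_sqr. Qed.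

Lemma nc_nat k : nc (k%:R) = k%:R.
Proof. by rewrite -(rmorph_nat (real_complex R)) nc_real normr_nat. Qed.

Lemma nc_sqr z : nc z ^+ 2 = complex.Re z ^+ 2 + complex.Im z ^+ 2.
Proof. by case: z => a b; rewrite /= sqr_sqrtr// addr_ge0 ?sqr_ge0. Qed.

Lemma nc_ReIm (a b : R) : nc (a +i* b)%C <= `|a| + `|b|.
Proof.
rewrite -ler_sqr ?nnegrE ?nc_ge0 ?addr_ge0// nc_sqr/= sqrrD.
by rewrite !real_normK ?num_real// addrAC lerDl mulrn_wge0// mulr_ge0.
Qed.

End Modulus.

(** * Epsilon-delta forms of limits, derivatives and continuity *)

Section EpsDelta.
Variable R : realType.
Local Notation C := R[i].
Local Notation nc := (@ComplexField.Normc.normc R).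
Implicit Types (f g : C -> C) (z w : C) (D : set C).

(** The norm of [R[i]] takes values in [R[i]], so library radii are complex. A positive one is real
    and equals its real part, which gives a radius in [R]. *)
Lemma near_nc z (P : C -> Prop) : (\forall w \near z, P w) <->
  exists2 d : R, 0 < d & forall w, nc (w - z) < d -> P w.
Proof.
split => [/nbhs_ballP[d /= d0 hd]|[d d0 hd]].
  have dE : d = (complex.Re d)%:C%C by rewrite RRe_real // gtr0_real.
  exists (complex.Re d) => [|w hw]; first by rewrite -ltcR -dE.
  by apply: hd; rewrite /ball/= ncE dE ltcR ncBC.
apply/nbhs_ballP; exists (d%:C)%C => [|w]; first by rewrite /= ltcR.
by rewrite /ball/= ncE ltcR ncBC; exact: hd.
Qed.

Lemma cvg_nc (T : Type) (F : set_system T) (f : T -> C) l : Filter F ->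
  f x @[x --> F] --> l <->
  forall e : R, 0 < e -> \forall x \near F, nc (f x - l) < e.
Proof.
move=> FF; apply: (iff_trans (@cvgrPdist_lt C C T F FF f l)); split => h e e0.
  have := h (e%:C)%C; rewrite ltcR => /(_ e0).
  by apply: filterS => x; rewrite ncE ltcR ncBC.
have eE : e = (complex.Re e)%:C%C by rewrite RRe_real // gtr0_real.
have /h : 0 < complex.Re e by rewrite -ltcR -eE.
by apply: filterS => x; rewrite ncE eE ltcR ncBC.
Qed.

Lemma derivable_nc f z : derivable f z 1 -> exists a : C, forall e : R, 0 < e ->
  exists2 d : R, 0 < d & forall w, nc (w - z) < d ->
    nc (f w - f z - a * (w - z)) <= e * nc (w - z).
Proof.
move=> /cvg_ex[/= a ha]; exists a => e e0.
have := (@cvg_nc _ _ _ a (dnbhs_filter (0 : C))).1 ha e e0.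
move=> /near_nc[d d0 hd]; exists d => // w hw.
have [->|wz] := eqVneq w z; first by rewrite !subrr mulr0 subr0 nc0 mulr0.
have h0 : w - z != 0 by rewrite subr_eq0.
have := hd (w - z); rewrite subr0 hw => /(_ isT h0) /ltW.
have -> : (w - z)%:A + z = w by rewrite /GRing.scale/= mulr1 subrK.
rewrite -(ler_pM2r (x := nc (w - z))) ?nc_gt0// -ncM mulrBl /GRing.scale/=.
by rewrite mulrAC mulVf// mul1r.
Qed.

Lemma continuous_nc D f : {within D, continuous f} -> forall z, D z ->
  forall e : R, 0 < e -> exists2 d : R, 0 < d &
    forall w, D w -> nc (w - z) < d -> nc (f w - f z) < e.
Proof.
move=> /subspace_continuousP hf z Dz e e0.
have := (@cvg_nc _ _ _ _ (within_filter D (nbhs_filter z))).1 (hf z Dz) e e0.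
rewrite near_withinE => /near_nc[d d0 hd].
by exists d => // w Dw hw; exact: hd.
Qed.

End EpsDelta.

(** * Compactness by bisection *)

Section Bisection.
Variable R : realType.

Lemma nested_point (a b : nat -> R) :
  (forall n, a n <= a n.+1) -> (forall n, b n.+1 <= b n) ->
  (forall n, a n <= b n) -> exists x, forall n, a n <= x <= b n.
Proof.
move=> ha hb hab.
have ndecr m n : (m <= n)%N -> a m <= a n.
  by move=> /subnK <-; elim: (n - m)%N => // k ih; rewrite addSn (le_trans ih).
have nincr m n : (m <= n)%N -> b n <= b m.
  by move=> /subnK <-; elim: (n - m)%N => // k ih; rewrite addSn (le_trans _ ih).
have ab m n : a m <= b n.
  rewrite (le_trans (ndecr _ (maxn m n) (leq_maxl _ _)))//.
  by rewrite (le_trans (hab _))// nincr// leq_maxr.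
have ub n : ubound (range a) (b n) by move=> _ [m _ <-].
have ne : range a !=set0 by exists (a 0%N), 0%N.
exists (sup (range a)) => n; apply/andP; split; last by apply: ge_sup.
by apply: ub_le_sup; [exists (b 0%N) | exists n].
Qed.

Lemma exp2_archi (L e : R) : 0 < e -> exists n, L / 2 ^+ n < e.
Proof.
move=> e0; exists (Num.truncn (L / e)).+1.
rewrite ltr_pdivrMr ?exprn_gt0// mulrC -ltr_pdivrMr//.
rewrite (lt_le_trans (truncnS_gt _))// -natrX ler_nat.
exact/ltnW/ltn_expl.
Qed.

(** Cousin's lemma in the plane: if [P] failed, choosing a bad quarter again and again would shrink
    to a point near which the local hypothesis makes [P] true. A side may have length zero, so the
    lemma also supplies compactness of intervals. *)
Lemma cousin2 (P : R -> R -> R -> R -> Prop) (x0 x1 y0 y1 : R) :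
  x0 <= x1 -> y0 <= y1 ->
  (forall a b c d, let m := (a + b) / 2 in let k := (c + d) / 2 in
    P a m c k -> P m b c k -> P a m k d -> P m b k d -> P a b c d) ->
  (forall x y, x0 <= x <= x1 -> y0 <= y <= y1 -> exists2 e : R, 0 < e &
    forall a b c d, x0 <= a -> a <= x <= b -> b <= x1 ->
      y0 <= c -> c <= y <= d -> d <= y1 -> b - a < e -> d - c < e ->
      P a b c d) ->
  P x0 x1 y0 y1.
Proof.
move=> x01 y01 split local; apply: contrapT => nP.
(* One bisection step: keep the first quarter violating [P]. The fourth is the default, and is bad
   whenever the other three are good and the whole is bad. *)
pose s (q : (R * R) * (R * R)) :=
  let: ((a, b), (c, d)) := q in
  let m := (a + b) / 2 in let k := (c + d) / 2 in
  if `[< ~ P a m c k >] then ((a, m), (c, k)) else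
  if `[< ~ P m b c k >] then ((m, b), (c, k)) else
  if `[< ~ P a m k d >] then ((a, m), (k, d)) else ((m, b), (k, d)).
pose q n := iter n s ((x0, x1), (y0, y1)).
pose a n := (q n).1.1; pose b n := (q n).1.2.
pose c n := (q n).2.1; pose d n := (q n).2.2.
have step n : [/\ ((a n.+1 = a n) /\ (b n.+1 = (a n + b n) / 2)) \/
      ((a n.+1 = (a n + b n) / 2) /\ (b n.+1 = b n)),
    ((c n.+1 = c n) /\ (d n.+1 = (c n + d n) / 2)) \/
      ((c n.+1 = (c n + d n) / 2) /\ (d n.+1 = d n)) &
    ~ P (a n) (b n) (c n) (d n) -> ~ P (a n.+1) (b n.+1) (c n.+1) (d n.+1)].
  rewrite /a /b /c /d /q iterS; case: (iter n s _) => [[u v] [z w]] /=.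
  case: asboolP => h1; first by split; [left|left|].
  case: asboolP => h2; first by split; [right|left|].
  case: asboolP => h3; first by split; [left|right|].
  split; [by right|by right|move=> nQ nQ'; apply: nQ].
  by apply: split => //; apply: contrapT.
have bad n : ~ P (a n) (b n) (c n) (d n).
  by elim: n => // n ih; case: (step n) => _ _ /(_ ih).
have width n : [/\ b n - a n = (x1 - x0) / 2 ^+ n, d n - c n = (y1 - y0) / 2 ^+ n,
    a n <= b n & c n <= d n].
  elim: n => [|n [ihx ihy ihab ihcd]]; first by rewrite !expr0 !divr1.
  have [hx hy _] := step n; rewrite !exprSr !invfM !mulrA -ihx -ihy.
  by split; [case: hx|case: hy|case: hx|case: hy] => -[? ?]; lra.
have mono n : [/\ a n <= a n.+1, b n.+1 <= b n, c n <= c n.+1 & d n.+1 <= d n].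
  have [_ _ ab cd] := width n; have [hx hy _] := step n.
  by split; [case: hx|case: hx|case: hy|case: hy] => -[? ?]; lra.
have [x hx] : exists x, forall n, a n <= x <= b n.
  by apply: nested_point => n; [case: (mono n)|case: (mono n)|case: (width n)].
have [y hy] : exists y, forall n, c n <= y <= d n.
  by apply: nested_point => n; [case: (mono n)|case: (mono n)|case: (width n)].
have [e e0 he] := local x y (hx 0%N) (hy 0%N).
have [N hN] := exp2_archi ((x1 - x0) + (y1 - y0)) e0.
have range n : [/\ x0 <= a n, b n <= x1, y0 <= c n & d n <= y1].
  elim: n => [|n [ix1 ix2 iy1 iy2]]; first by rewrite !lexx.
  by have [m1 m2 m3 m4] := mono n; split; lra.
have [r1 r2 r3 r4] := range N; have [w1 w2 _ _] := width N.
have ex : (x1 - x0) / 2 ^+ N <= (x1 - x0 + (y1 - y0)) / 2 ^+ N.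
  by rewrite ler_pM2r ?invr_gt0 ?exprn_gt0// lerDl subr_ge0.
have ey : (y1 - y0) / 2 ^+ N <= (x1 - x0 + (y1 - y0)) / 2 ^+ N.
  by rewrite ler_pM2r ?invr_gt0 ?exprn_gt0// lerDr subr_ge0.
apply: (bad N); apply: he => //; rewrite ?w1 ?w2.
- exact: le_lt_trans ex hN.
- exact: le_lt_trans ey hN.
Qed.

End Bisection.

(** * Goursat's theorem for dyadic contour sums *)

Section Goursat.
Variable R : realType.
Local Notation C := R[i].
Local Notation nc := (@ComplexField.Normc.normc R).

Definition lsum n (f : R -> C) (a b : R) : C :=
  ((b - a) / 2 ^+ n)%:C%C *
  \sum_(k < 2 ^ n) f (a + k%:R * ((b - a) / 2 ^+ n)).

(** Level [n.+1] on the whole interval and level [n] on each half have the same mesh width and the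
    same left endpoints. *)
Lemma lsum_split n f a b (m := (a + b) / 2) :
  lsum n.+1 f a b = lsum n f a m + lsum n f m b.
Proof.
have n0 : (2 ^+ n : R) != 0 by rewrite expf_neq0.
rewrite /lsum (_ : (2 ^ n.+1 = 2 ^ n + 2 ^ n)%N); last first.
  by rewrite expnS mul2n addnn.
rewrite big_split_ord/= mulrDr.
have -> : (b - a) / 2 ^+ n.+1 = (m - a) / 2 ^+ n.
  by rewrite /m exprS; field.
congr (_ * _ + _).
have -> : (b - m) / 2 ^+ n = (m - a) / 2 ^+ n by rewrite /m; field.
congr (_ * _); apply: eq_bigr => k _; congr f.
by rewrite natrD natrX /m; field.
Qed.

Lemma lsumD n f g a b :
  lsum n (fun t => f t + g t) a b = lsum n f a b + lsum n g a b.
Proof. by rewrite /lsum big_split mulrDr. Qed.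

Lemma lsum_le n f a b B : a <= b ->
  (forall t, a <= t <= b -> nc (f t) <= B) -> nc (lsum n f a b) <= (b - a) * B.
Proof.
move=> ab hf; have n0 : 0 < (2 ^+ n : R) by rewrite exprn_gt0.
have h0 : 0 <= (b - a) / 2 ^+ n by rewrite divr_ge0 ?subr_ge0// ltW.
rewrite /lsum ncM nc_real ger0_norm//.
have -> : (b - a) * B = (b - a) / 2 ^+ n * (2 ^+ n * B) by field; rewrite gt_eqF.
apply: ler_wpM2l => //; apply: (le_trans (nc_sum _ _ _)).
have -> : 2 ^+ n * B = \sum_(k < 2 ^ n) B.
  by rewrite sumr_const card_ord -[RHS]mulr_natl natrX.
apply: ler_sum => k _; apply: hf.
have k1 : k%:R * ((b - a) / 2 ^+ n) <= 2 ^+ n * ((b - a) / 2 ^+ n).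
  rewrite ler_wpM2r//. rewrite -(natrX R 2 n) ler_nat ltnW//.
rewrite lerDl mulr_ge0//= -lerBrDl (le_trans k1)// mulrC divfK ?gt_eqF//.
Qed.

Lemma lsumDc n f g al a b : (forall t, f t = g t + al) ->
  lsum n f a b = lsum n g a b + (b - a)%:C%C * al.
Proof.
move=> hf; rewrite (_ : f = fun t => g t + al); last exact: funext.
rewrite lsumD; congr (_ + _); rewrite /lsum sumr_const card_ord -[X in _ * X]mulr_natl mulrA.
congr (_ * _); rewrite -(rmorph_nat (real_complex R)) -rmorphM/= natrX.
by congr (_%:C)%C; rewrite divfK// expf_neq0.
Qed.

(* Opposite sides carry the same orientation and the same sample points, so that
   [rsum_split] and [rsum_affine] are exact and not merely asymptotic. *)
Definition rsum n (F : R -> R -> C) (a b c d : R) : C :=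
  lsum n (F^~ c) a b - lsum n (F^~ d) a b
  + 'i%C * (lsum n (F b) c d - lsum n (F a) c d).

Lemma rsum_split n F a b c d (m := (a + b) / 2) (k := (c + d) / 2) :
  rsum n.+1 F a b c d =
  rsum n F a m c k + rsum n F m b c k + rsum n F a m k d + rsum n F m b k d.
Proof. by rewrite /rsum !lsum_split -/m -/k; ring. Qed.

Lemma rsumD n F G a b c d :
  rsum n (fun x y => F x y + G x y) a b c d = rsum n F a b c d + rsum n G a b c d.
Proof. by rewrite /rsum !lsumD; ring. Qed.

(** On opposite sides an affine function differs by a constant, [be * 'i * (c - d)] for the
    horizontal pair and [be * (b - a)] for the vertical one. Multiplied by the side lengths, the two
    contributions cancel. *)
Lemma rsum_affine n (al be : C) a b c d :
  rsum n (fun x y => al + be * (x +i* y)%C) a b c d = 0.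
Proof.
pose F (x y : R) := al + be * (x +i* y)%C.
have h1 : lsum n (F^~ c) a b =
    lsum n (F^~ d) a b + (b - a)%:C%C * (be * ('i%C * (c - d)%:C%C)).
  apply: lsumDc => x; rewrite /F -addrA -mulrDr; congr (_ + _ * _).
  by apply/eqP; rewrite eq_complex/=; apply/andP; split; apply/eqP; ring.
have h2 : lsum n (F b) c d =
    lsum n (F a) c d + (d - c)%:C%C * (be * (b - a)%:C%C).
  apply: lsumDc => y; rewrite /F -addrA -mulrDr; congr (_ + _ * _).
  by apply/eqP; rewrite eq_complex/=; apply/andP; split; apply/eqP; ring.
by rewrite /rsum h1 h2 !(rmorphB (real_complex R)); ring.
Qed.

Lemma rsum_le n F a b c d B : a <= b -> c <= d ->
  (forall x y, a <= x <= b -> c <= y <= d -> nc (F x y) <= B) ->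
  nc (rsum n F a b c d) <= 2 * ((b - a) + (d - c)) * B.
Proof.
move=> ab cd hF.
have h1 : nc (lsum n (F^~ c) a b) <= (b - a) * B.
  by apply: lsum_le => // t ht; apply: hF; rewrite ?lexx.
have h2 : nc (lsum n (F^~ d) a b) <= (b - a) * B.
  by apply: lsum_le => // t ht; apply: hF; rewrite ?lexx ?cd.
have h3 : nc (lsum n (F b) c d) <= (d - c) * B.
  by apply: lsum_le => // t ht; apply: hF; rewrite ?lexx ?ab.
have h4 : nc (lsum n (F a) c d) <= (d - c) * B.
  by apply: lsum_le => // t ht; apply: hF; rewrite ?lexx ?ab.
have i1 : nc 'i%C = 1 by rewrite /= expr0n expr1n add0r sqrtr1.
rewrite /rsum; apply: (le_trans (ncD _ _)); rewrite ncM i1 mul1r.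
have := ncB (lsum n (F^~ c) a b) (lsum n (F^~ d) a b).
have := ncB (lsum n (F b) c d) (lsum n (F a) c d).
lra.
Qed.

(** Complex differentiability in real coordinates: the linear part is multiplication by the complex
    number [al]. *)
Definition cdiff2 (F : R -> R -> C) (x y : R) := exists al : C,
  forall e : R, 0 < e -> exists2 d : R, 0 < d &
    forall x' y', `|x' - x| < d -> `|y' - y| < d ->
      nc (F x' y' - F x y - al * ((x' - x) +i* (y' - y))%C)
      <= e * (`|x' - x| + `|y' - y|).

(** The bound is proved proportional to the square of width plus height. Quartering divides that
    square by four, so the bounds of the four quarters add up to that of the whole; near a point of
    differentiability it comes from the affine approximation. *)
Lemma goursat (F : R -> R -> C) a b c d : a <= b -> c <= d ->
  (forall x y, a <= x <= b -> c <= y <= d -> cdiff2 F x y) ->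
  forall e : R, 0 < e -> exists N, forall n, (N <= n)%N ->
    nc (rsum n F a b c d) <= e.
Proof.
move=> ab cd hF e e0.
(* The [+ 1] keeps the divisor positive for a degenerate rectangle. *)
pose e' := e / ((b - a + (d - c)) ^+ 2 + 1).
have e'0 : 0 < e' by rewrite divr_gt0// ltr_wpDl ?sqr_ge0.
suff [N hN] : exists N, forall n, (N <= n)%N ->
    nc (rsum n F a b c d) <= e' * (b - a + (d - c)) ^+ 2.
  exists N => n /hN /le_trans; apply.
  by rewrite /e' mulrAC ler_pdivrMr ?ltr_wpDl ?sqr_ge0// ler_pM2l// lerDl.
clearbody e'.
apply: (cousin2 (P := fun a b c d => exists N, forall n, (N <= n)%N ->
    nc (rsum n F a b c d) <= e' * (b - a + (d - c)) ^+ 2)) => //.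
- move=> {hF ab cd a b c d e e0 e'0} a b c d m k [N1 h1] [N2 h2] [N3 h3] [N4 h4].
  (* Splitting lowers the level by one, hence the successor. *)
  exists (N1 + N2 + N3 + N4).+1 => -[//|n] hn; rewrite rsum_split.
  rewrite -/m -/k.
  have {h1} : nc (rsum n F a m c k) <= _ := h1 n ltac:(lia).
  have {h2} : nc (rsum n F m b c k) <= _ := h2 n ltac:(lia).
  have {h3} : nc (rsum n F a m k d) <= _ := h3 n ltac:(lia).
  have {h4} : nc (rsum n F m b k d) <= _ := h4 n ltac:(lia).
  have -> : m - a + (k - c) = (b - a + (d - c)) / 2 by rewrite /m /k; field.
  have -> : b - m + (k - c) = (b - a + (d - c)) / 2 by rewrite /m /k; field.
  have -> : m - a + (d - k) = (b - a + (d - c)) / 2 by rewrite /m /k; field.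
  have -> : b - m + (d - k) = (b - a + (d - c)) / 2 by rewrite /m /k; field.
  have -> : e' * ((b - a + (d - c)) / 2) ^+ 2 = e' * (b - a + (d - c)) ^+ 2 / 4.
    by field.
  move=> h4 h3 h2 h1.
  have := ncD (rsum n F a m c k + rsum n F m b c k + rsum n F a m k d)
    (rsum n F m b k d).
  have := ncD (rsum n F a m c k + rsum n F m b c k) (rsum n F a m k d).
  have := ncD (rsum n F a m c k) (rsum n F m b c k).
  lra.
- move=> x y hx hy; have [al hal] := hF x y hx hy.
  have [del del0 hdel] := hal (e' / 2) (divr_gt0 e'0 (ltr0Sn _ 1)).
  exists del => // {hF hx hy ab cd e e0 hal} a' b' c' d' _ hx _ _ hy _ hb hd; exists 0%N => n _.
  (* [L] is the affine approximation at the centre, with contour sum zero; only the remainder [H] is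
     left to estimate. *)
  pose H x' y' := F x' y' - F x y - al * ((x' - x) +i* (y' - y))%C.
  pose L x' y' := (F x y - al * (x +i* y)%C) + al * (x' +i* y')%C.
  have -> : F = (fun x' y' => H x' y' + L x' y').
    apply/funext => x'; apply/funext => y'; rewrite /H /L.
    have -> : ((x' - x) +i* (y' - y))%C = (x' +i* y')%C - (x +i* y)%C by [].
    by ring.
  rewrite rsumD rsum_affine addr0.
  have -> : e' * (b' - a' + (d' - c')) ^+ 2 =
    2 * (b' - a' + (d' - c')) * (e' / 2 * (b' - a' + (d' - c'))) by field.
  apply: rsum_le; [lra|lra|move=> x' y' hx' hy'].
  have hxx : `|x' - x| <= b' - a' by rewrite ler_norml; lra.
  have hyy : `|y' - y| <= d' - c' by rewrite ler_norml; lra.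
  apply: (le_trans (hdel _ _ _ _)); [lra|lra|].
  by rewrite ler_pM2l ?divr_gt0//; lra.
Qed.

End Goursat.

(** * The complex exponential as logarithmic polar coordinates *)

Section Polar.
Variable R : realType.
Local Notation C := R[i].
Local Notation nc := (@ComplexField.Normc.normc R).

(** The exponential of [s + i t]: it carries the line at level [s] to the circle of radius [expR s],
    so that an annulus becomes a rectangle. *)
Definition pol (s t : R) : C := (expR s * cos t +i* (expR s * sin t))%C.

Lemma polD s t s' t' : pol (s + s') (t + t') = pol s t * pol s' t'.
Proof.
rewrite /pol expRD cosD sinD; apply/eqP; rewrite eq_complex/=.
by apply/andP; split; apply/eqP; ring.
Qed.

Lemma pol0 : pol 0 0 = 1.
Proof. by rewrite /pol expR0 cos0 sin0 !mul1r. Qed.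

Lemma nc_pol s t : nc (pol s t) = expR s.
Proof.
apply/eqP; rewrite -(eqrXn2 (n := 2)) ?nc_ge0 ?expR_ge0//; apply/eqP.
by rewrite nc_sqr/= !exprMn -mulrDr cos2Dsin2 mulr1.
Qed.

Lemma pol_neq0 s t : pol s t != 0.
Proof. by rewrite -nc_gt0 nc_pol expR_gt0. Qed.

Lemma polN s t : pol (- s) (- t) = (pol s t)^-1.
Proof.
by apply: (mulfI (pol_neq0 s t)); rewrite -polD !subrr pol0 mulfV// pol_neq0.
Qed.

Lemma pol_2pi s t : pol s (t + pi *+ 2) = pol s t.
Proof. by rewrite /pol cosD2pi sinD2pi. Qed.

Lemma polX s t k : pol s t ^+ k = pol (k%:R * s) (k%:R * t).
Proof.
elim: k => [|k ih]; first by rewrite !mul0r pol0.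
by rewrite exprSr ih -polD -(natr1 k) !mulrDl !mul1r.
Qed.

Lemma is_derive_eps (f : R -> R) (x a : R) : is_derive x 1 f a ->
  forall e : R, 0 < e -> exists2 d : R, 0 < d &
    forall h : R, `|h| < d -> `|f (x + h) - f x - a * h| <= e * `|h|.
Proof.
move=> [/cvg_ex[/= l hl] fa] e e0.
have la : l = a by rewrite -fa; apply/esym/cvg_lim.
rewrite la {la fa} in hl; move/cvgrPdist_lt : hl => /(_ e e0) /nbhs_ballP[d /= d0 hd].
exists d => // h hh; have [->|h0] := eqVneq h 0.
  by rewrite addr0 subrr mulr0 subr0 normr0 mulr0.
have := hd h; rewrite /ball/= sub0r normrN => /(_ hh h0) /ltW.
rewrite -(ler_pM2r (x := `|h|)) ?normr_gt0// -normrM distrC.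
rewrite /GRing.scale/= mulr1 mulrBl mulrAC mulVf// mul1r.
by rewrite [h + x]addrC.
Qed.

Lemma pol_approx (e : R) : 0 < e -> exists2 d : R, 0 < d & forall s t,
  `|s| < d -> `|t| < d -> nc (pol s t - 1 - (s +i* t)%C) <= e * (`|s| + `|t|).
Proof.
(* The four remainders below add up to at most [e1 * |s| + (3 + 2 + 3) * e1 * |t|], hence the 8. *)
move=> e0; pose e1 := Num.min (e / 8) 1.
have e10 : 0 < e1 by rewrite lt_min divr_gt0/=.
have e1e : 8 * e1 <= e by rewrite mulrC -ler_pdivlMr// ge_min lexx.
have e11 : e1 <= 1 by rewrite ge_min lexx orbT.
clearbody e1.
have [d1 d10 h1] := is_derive_eps (is_derive_expR (0 : R)) e10.
have [d2 d20 h2] := is_derive_eps (is_derive_cos (0 : R)) e10.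
have [d3 d30 h3] := is_derive_eps (is_derive_sin (0 : R)) e10.
exists (Num.min (Num.min d1 e1) (Num.min d2 d3)) => [|s t].
  by rewrite !lt_min d10 d20 d30 e10.
rewrite !lt_min => /andP[/andP[s1 s2] _] /andP[_ /andP[t2 t3]].
have := h1 s s1; have := h2 t t2; have := h3 t t3.
rewrite !(add0r, expR0, cos0, sin0, subr0, oppr0, mul0r, mul1r) => k3 k2 k1.
have eq : pol s t - 1 - (s +i* t)%C =
  (((expR s - 1 - s) + expR s * (cos t - 1)) +i*
   ((expR s - 1) * t + expR s * (sin t - t)))%C.
  by apply/eqP; rewrite eq_complex/=; apply/andP; split; apply/eqP; ring.
have s1' : `|s| <= 1 by rewrite (le_trans (ltW s2)).
have es1 : `|expR s - 1| <= 2 * `|s|.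
  have -> : expR s - 1 = (expR s - 1 - s) + s by ring.
  rewrite (le_trans (ler_normD _ _))// mulrDl mul1r lerD2r (le_trans k1)//.
  by rewrite ler_piMl.
have es3 : expR s <= 3.
  by move: es1; rewrite ler_norml; lra.
rewrite eq (le_trans (nc_ReIm _ _))//.
have a1 := ler_normD (expR s - 1 - s) (expR s * (cos t - 1)).
have a2 := ler_normD ((expR s - 1) * t) (expR s * (sin t - t)).
have b1 : `|expR s * (cos t - 1)| <= 3 * (e1 * `|t|).
  by rewrite normrM ger0_norm ?expR_ge0// ler_pM ?expR_ge0.
have b2 : `|expR s * (sin t - t)| <= 3 * (e1 * `|t|).
  by rewrite normrM ger0_norm ?expR_ge0// ler_pM ?expR_ge0.
have b3 : `|(expR s - 1) * t| <= 2 * (e1 * `|t|).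
  rewrite normrM mulrA ler_wpM2r// (le_trans es1)// ler_pM2l//.
  exact: ltW.
have c1 : 8 * e1 * (`|s| + `|t|) <= e * (`|s| + `|t|).
  by rewrite ler_wpM2r// addr_ge0.
have c2 : 0 <= e1 * `|s| by rewrite mulr_ge0// ltW.
lra.
Qed.

(** Chain rule through the exponential, whose derivative at the point is [u] itself; this gives
    [a * u]. The remainder of [g] (through [e2]) and that of [pol] (through [e1]) each take half of
    [e]. *)
Lemma cdiff2_pol (g : C -> C) s t :
  derivable g (pol s t) 1 -> cdiff2 (fun s t => g (pol s t)) s t.
Proof.
move=> /derivable_nc[a ha]; pose u := pol s t.
exists (a * u) => e e0.
have u0 : 0 < nc u by rewrite nc_gt0 pol_neq0.
pose e1 := e / (2 * (nc a * nc u + 1)).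
have q0 : 0 < nc a * nc u + 1 by rewrite ltr_wpDl// mulr_ge0 ?nc_ge0.
have e10 : 0 < e1 by rewrite divr_gt0// mulr_gt0.
pose e2 := e / (2 * ((e1 + 1) * nc u)).
have p0 : 0 < (e1 + 1) * nc u by rewrite mulr_gt0// addr_gt0.
have e20 : 0 < e2 by rewrite divr_gt0// mulr_gt0.
have [d1 d10 h1] := pol_approx e10.
have [d2 d20 h2] := ha e2 e20.
pose d3 := d2 / (2 * ((e1 + 1) * nc u)).
have d30 : 0 < d3 by rewrite divr_gt0// mulr_gt0.
exists (Num.min d1 d3); first by rewrite lt_min d10.
move=> s' t'; rewrite !lt_min => /andP[sd1 sd3] /andP[td1 td3].
set m := `|s' - s| + `|t' - t|.
have m0 : 0 <= m by rewrite addr_ge0.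
have := h1 _ _ sd1 td1; rewrite -/m; set w := (_ +i* _)%C => k1.
have uE : pol s' t' = u * pol (s' - s) (t' - t).
  by rewrite /u -polD ![_ + (_ - _)]addrC !subrK.
have duE : pol s' t' - u = u * (pol (s' - s) (t' - t) - 1).
  by rewrite uE mulrBr mulr1.
have k2 : nc (pol (s' - s) (t' - t) - 1) <= (e1 + 1) * m.
  have -> : pol (s' - s) (t' - t) - 1 = (pol (s' - s) (t' - t) - 1 - w) + w.
    by rewrite subrK.
  rewrite (le_trans (ncD _ _))// mulrDl mul1r lerD//.
  exact: nc_ReIm.
have k3 : nc (pol s' t' - u) <= (e1 + 1) * nc u * m.
  by rewrite duE ncM mulrAC [nc u * _]mulrC ler_wpM2r ?nc_ge0.
have md : m < 2 * d3 by rewrite /m; lra.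
have k4 : nc (pol s' t' - u) < d2.
  apply: (le_lt_trans k3); rewrite mulrC -ltr_pdivlMr//.
  apply: (lt_le_trans md); rewrite /d3 invfM mulrA le_eqVlt; apply/orP; left.
  by apply/eqP; field; rewrite gt_eqF ?nc_gt0 ?pol_neq0//= gt_eqF// addr_gt0.
have k5 := h2 _ k4.
have -> : g (pol s' t') - g u - a * u * w =
    (g (pol s' t') - g u - a * (pol s' t' - u))
    + a * u * (pol (s' - s) (t' - t) - 1 - w).
  by rewrite duE; ring.
rewrite (le_trans (ncD _ _))// !ncM.
have k6 : e2 * nc (pol s' t' - u) <= e / 2 * m.
  apply: (@le_trans _ _ (e2 * ((e1 + 1) * nc u * m))); first by rewrite ler_pM2l.
  rewrite le_eqVlt; apply/orP; left; apply/eqP; rewrite /e2; field.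
  by rewrite gt_eqF ?nc_gt0 ?pol_neq0//= gt_eqF// addr_gt0.
have k7 : nc a * nc u * nc (pol (s' - s) (t' - t) - 1 - w) <= e / 2 * m.
  apply: (@le_trans _ _ ((nc a * nc u + 1) * (e1 * m))).
    apply: ler_pM => //; rewrite ?nc_ge0 ?mulr_ge0 ?nc_ge0//.
    by rewrite lerDl.
  by rewrite le_eqVlt; apply/orP; left; apply/eqP; rewrite /e1; field; rewrite gt_eqF.
lra.
Qed.

Lemma cdiff2_continuous (F : R -> R -> C) s t : cdiff2 F s t ->
  forall e : R, 0 < e -> exists2 d : R, 0 < d & forall s' t',
    `|s' - s| < d -> `|t' - t| < d -> nc (F s' t' - F s t) < e.
Proof.
move=> [al hal] e e0; have [d d0 hd] := hal 1 ltr01.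
have q0 : 0 < 2 * (nc al + 1) + 1.
  by rewrite ltr_wpDl// mulr_ge0// addr_ge0// nc_ge0.
exists (Num.min d (e / (2 * (nc al + 1) + 1))).
  by rewrite lt_min d0 divr_gt0.
move=> s' t'; rewrite !lt_min => /andP[sd sd'] /andP[td td'].
have k1 := hd _ _ sd td; move: k1; set w := (_ +i* _)%C => k1.
have -> : F s' t' - F s t = (F s' t' - F s t - al * w) + al * w by rewrite subrK.
apply: (le_lt_trans (ncD _ _)); rewrite ncM.
have k2 : nc al * nc w <= nc al * (`|s' - s| + `|t' - t|).
  by rewrite ler_wpM2l ?nc_ge0// nc_ReIm.
have k3 : (nc al + 1) * (`|s' - s| + `|t' - t|) <=
   (nc al + 1) * (2 * (e / (2 * (nc al + 1) + 1))).
  by rewrite ler_wpM2l ?addr_ge0 ?nc_ge0//; lra.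
have k4 : (nc al + 1) * (2 * (e / (2 * (nc al + 1) + 1))) < e.
  rewrite !mulrA ltr_pdivrMr// [e * _]mulrC ltr_pM2r//; lra.
lra.
Qed.

End Polar.

(** * Discrete means over circles and their deformation *)

Section CircularMeans.
Variable R : realType.
Local Notation C := R[i].
Local Notation nc := (@ComplexField.Normc.normc R).
Variables (F : R -> R -> C) (L s0 : R).

Definition cmean n s : C :=
  (2 ^+ n)^-1 * \sum_(k < 2 ^ n) F s (k%:R * (pi *+ 2 / 2 ^+ n)).

Hypothesis L0 : 0 < L.
(* [s0] is the level of the removable singularity: [F] is only continuous there. *)
Hypothesis s0L : 0 <= s0 < L.
Hypothesis Fcont : forall s t, 0 <= s <= L -> forall e : R, 0 < e ->
  exists2 d : R, 0 < d & forall s' t', 0 <= s' <= L ->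
    `|s' - s| < d -> `|t' - t| < d -> nc (F s' t' - F s t) < e.
Hypothesis Fdiff : forall s t, 0 < s < L -> s != s0 -> cdiff2 F s t.
Hypothesis Fper : forall s t, F s (t + pi *+ 2) = F s t.
Hypothesis Fodd : forall t, F 0 (- t) = - F 0 t.

(** The reflection [k -> 2 ^ n - k] sends each sample angle to its negative modulo the period, so by
    oddness the sum equals its own negative. *)
Lemma cmean0 n : cmean n 0 = 0.
Proof.
rewrite /cmean; set h := _ / _.
have hN : (2 ^ n)%:R * h = pi *+ 2.
  by rewrite /h natrX mulrC divfK// expf_neq0.
pose g k := F 0 (k%:R * h).
(* Both end angles contribute zero, so the sum may be extended to [k = 2 ^ n], which makes the range
   symmetric. *)
have F00 : F 0 0 = 0.
  have /eqP := Fodd 0; rewrite oppr0 -subr_eq0 opprK -mulr2n mulrn_eq0/=.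
  by move/eqP.
have gN : g (2 ^ n)%N = 0 by rewrite /g hN -[pi *+ 2]add0r Fper.
rewrite -(big_mkord xpredT g).
suff : \sum_(0 <= k < 2 ^ n) g k = 0 by move=> ->; rewrite mulr0.
have e1 : \sum_(0 <= k < (2 ^ n).+1) g k = \sum_(0 <= k < 2 ^ n) g k.
  by rewrite big_nat_recr//= gN addr0.
have e2 : \sum_(0 <= k < (2 ^ n).+1) g k = - \sum_(0 <= k < (2 ^ n).+1) g k.
  rewrite {1}big_nat_rev/= -sumrN; apply: eq_big_nat => k; rewrite ltnS => kN.
  by rewrite add0n subSS /g natrB// mulrBl hN addrC Fper Fodd.
apply/eqP; move/eqP: e2; rewrite e1 -subr_eq0 opprK -mulr2n mulrn_eq0/=.
by [].
Qed.

Lemma cmean_le n s s' e : 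
  (forall t, 0 <= t <= pi *+ 2 -> nc (F s' t - F s t) <= e) ->
  nc (cmean n s' - cmean n s) <= e.
Proof.
move=> h; rewrite /cmean -mulrBr -sumrB ncM ncV ncX.
have -> : nc (2 : C) = 2 by rewrite nc_nat.
rewrite mulrC ler_pdivrMr ?exprn_gt0//.
apply: (le_trans (nc_sum _ _ _)).
have -> : e * 2 ^+ n = \sum_(k < 2 ^ n) e.
  by rewrite sumr_const card_ord -[RHS]mulr_natr natrX.
apply: ler_sum => k _; apply: h.
have p0 : 0 <= (pi : R) *+ 2 by rewrite mulrn_wge0// pi_ge0.
rewrite mulr_ge0 ?divr_ge0 ?exprn_ge0//=.
rewrite mulrCA ger_pMr; last by rewrite mulrn_wgt0 ?pi_gt0.
by rewrite ler_pdivrMr ?exprn_gt0// mul1r -natrX ler_nat ltnW.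
Qed.

(** Continuity in [s] made uniform over one period in [t], by [cousin2] on a rectangle of width
    zero. *)
Lemma tube_continuity s (e : R) : 0 <= s <= L -> 0 < e -> exists2 d : R, 0 < d &
  forall s' t, 0 <= s' <= L -> `|s' - s| < d -> 0 <= t <= pi *+ 2 ->
    nc (F s' t - F s t) <= e.
Proof.
move=> hs e0.
have p0 : 0 <= (pi : R) *+ 2 by rewrite mulrn_wge0// pi_ge0.
apply: (@cousin2 R (fun _ _ c d' => exists2 d : R, 0 < d &
  forall s' t, 0 <= s' <= L -> `|s' - s| < d -> c <= t <= d' ->
    nc (F s' t - F s t) <= e) 0 0 0 (pi *+ 2)) => //.
  move=> a b c d m k [d1 d10 h1] _ [d2 d20 h2] _.
  exists (Num.min d1 d2); first by rewrite lt_min d10.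
  move=> s' t hs'; rewrite lt_min => /andP[k1 k2] /andP[ct td].
  by have [tk|kt] := leP t k; [apply: h1 => //; rewrite ct|apply: h2 => //; rewrite ltW].
move=> x y _ _; have e20 : 0 < e / 2 by rewrite divr_gt0.
have [d d0 hd] := Fcont y hs e20; exists d => // a b c d' _ _ _ _ hy _ _ hdc.
exists d => // s' t hs' sd ht.
have td : `|t - y| < d by rewrite ltr_norml; lra.
have -> : F s' t - F s t = (F s' t - F s y) - (F s t - F s y) by ring.
apply: (le_trans (ncB _ _)).
have := hd s' t hs' sd td; have := hd s t hs _ td.
by rewrite subrr normr0 => /(_ d0); lra.
Qed.

(** Asymptotic equality of the means at two levels. Convergence of either mean is not asserted, and
    the relation can be chained. *)
Definition mclose s s' := forall e : R, 0 < e -> exists N, forall n, (N <= n)%N ->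
  nc (cmean n s - cmean n s') <= e.

Lemma mclose_sym s s' : mclose s s' -> mclose s' s.
Proof.
by move=> h e /h[N hN]; exists N => n /hN; rewrite ncBC.
Qed.

Lemma mclose_trans s s' s'' : mclose s s' -> mclose s' s'' -> mclose s s''.
Proof.
move=> h1 h2 e e0; have e20 : 0 < e / 2 by rewrite divr_gt0.
have [N1 hN1] := h1 _ e20; have [N2 hN2] := h2 _ e20.
exists (N1 + N2)%N => n hn.
have k1 := hN1 n (leq_trans (leq_addr _ _) hn).
have k2 := hN2 n (leq_trans (leq_addl _ _) hn).
have -> : cmean n s - cmean n s'' =
  (cmean n s - cmean n s') + (cmean n s' - cmean n s'') by ring.
by apply: (le_trans (ncD _ _)); lra.
Qed.

(** Serves the levels where [F] is only continuous: by [tube_continuity] the means at [p] are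
    uniformly near those at neighbouring levels. *)
Lemma mclose_lim s p : 0 <= p <= L ->
  (forall d, 0 < d -> exists s', [/\ 0 <= s' <= L, `|s' - p| < d & mclose s' s]) ->
  mclose p s.
Proof.
move=> hp h e e0; have e20 : 0 < e / 2 by rewrite divr_gt0.
have [d d0 hd] := tube_continuity hp e20; have [s' [hs' s'p cl]] := h d d0.
have [N hN] := cl _ e20; exists N => n /hN k1.
have k2 : nc (cmean n s' - cmean n p) <= e / 2.
  by apply: cmean_le => t ht; apply: hd.
have -> : cmean n p - cmean n s =
  (cmean n s' - cmean n s) - (cmean n s' - cmean n p) by ring.
by apply: (le_trans (ncB _ _)); lra.
Qed.

(** Goursat on the rectangle from [s] to [s'] over one period: periodicity cancels the horizontal
    sides, and the vertical ones are the means times the period. *)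
Lemma mclose_goursat s s' : 0 < s -> s <= s' -> s' < L ->
  (s0 < s) || (s' < s0) -> mclose s s'.
Proof.
move=> hs ss' s'L hs0 e e0.
have p0 : 0 < (pi : R) *+ 2 by rewrite mulrn_wgt0// pi_gt0.
have [||N hN] := @goursat R F s s' 0 (pi *+ 2) ss' (ltW p0) _ (pi *+ 2 * e).
- move=> x y hx _; apply: Fdiff; first by lra.
  by apply/eqP => xs0; case/orP: hs0; lra.
- by rewrite mulr_gt0.
exists N => n /hN; rewrite /rsum.
have -> : lsum n (F^~ 0) s s' = lsum n (F^~ (pi *+ 2)) s s'.
  by rewrite /lsum; congr (_ * _); apply: eq_bigr => k _; rewrite -[pi *+ 2]add0r Fper.
rewrite subrr add0r.
have E x : lsum n (F x) 0 (pi *+ 2) = (pi *+ 2)%:C%C * cmean n x.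
  rewrite /lsum /cmean subr0 mulrA; congr (_ * _).
    by rewrite rmorphM fmorphV rmorphXn rmorph_nat.
  by apply: eq_bigr => k _; rewrite add0r.
rewrite !E -mulrBr !ncM nc_real (gtr0_norm p0).
have -> : nc ('i%C : C) = 1 by rewrite /= expr0n expr1n add0r sqrtr1.
by rewrite mul1r ler_pM2l// ncBC.
Qed.

(** The chain of levels is [L], [m], [s0], [q], [0]. Goursat works strictly inside each of the two
    strips cut out by [s0]; the levels [L], [s0] and [0] are reached as limits. At level 0 the mean
    vanishes by oddness. *)
Lemma cmean_vanish (e : R) : 0 < e -> exists N, forall n, (N <= n)%N ->
  nc (cmean n L) <= e.
Proof.
suff cl : mclose L 0.
  by move=> /cl[N hN]; exists N => n /hN; rewrite cmean0 subr0.
have [s00 s0l] := andP s0L.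
pose m := (s0 + L) / 2.
have hm : s0 < m < L by rewrite /m; lra.
have LL : 0 <= L <= L by rewrite lexx ltW.
have cl2 : mclose L m.
  apply: mclose_lim => // d d0; exists (Num.max m (L - d / 2)).
  have M1 : m <= Num.max m (L - d / 2) by rewrite le_max lexx.
  have M2 : L - d / 2 <= Num.max m (L - d / 2) by rewrite le_max lexx orbT.
  have M3 : Num.max m (L - d / 2) < L by rewrite gt_max; lra.
  split; [lra|by rewrite ltr_norml; lra|apply: mclose_sym].
  by apply: mclose_goursat => //; [lra|apply/orP; left; lra].
have cl1 : mclose s0 m.
  apply: mclose_lim => [|d d0]; first by lra.
  exists (Num.min m (s0 + d / 2)).
  have M1 : Num.min m (s0 + d / 2) <= m by rewrite ge_min lexx.
  have M2 : Num.min m (s0 + d / 2) <= s0 + d / 2 by rewrite ge_min lexx orbT.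
  have M3 : s0 < Num.min m (s0 + d / 2) by rewrite lt_min; lra.
  split; [lra|by rewrite ltr_norml; lra|].
  by apply: mclose_goursat => //; [lra|lra|apply/orP; left; lra].
apply: (mclose_trans cl2); apply: mclose_sym.
(* If the singular level is the unit circle itself, there is no inner strip to cross. *)
have [s0E|s0n] := eqVneq s0 0; first by rewrite -{1}s0E.
have s0p : 0 < s0 by rewrite lt_def s0n.
apply: (mclose_trans _ cl1).
pose q := s0 / 2; have hq : 0 < q < s0 by rewrite /q; lra.
apply: (@mclose_trans _ q).
  apply: mclose_lim => [|d d0]; first by lra.
  exists (Num.min q (d / 2)).
  have M1 : Num.min q (d / 2) <= q by rewrite ge_min lexx.
  have M2 : Num.min q (d / 2) <= d / 2 by rewrite ge_min lexx orbT.
  have M3 : 0 < Num.min q (d / 2) by rewrite lt_min; lra.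
  split; [lra|by rewrite ltr_norml; lra|].
  by apply: mclose_goursat => //; [lra|apply/orP; right; lra].
apply: mclose_sym; apply: mclose_lim => [|d d0]; first by lra.
exists (Num.max q (s0 - d / 2)).
have M1 : q <= Num.max q (s0 - d / 2) by rewrite le_max lexx.
have M2 : s0 - d / 2 <= Num.max q (s0 - d / 2) by rewrite le_max lexx orbT.
have M3 : Num.max q (s0 - d / 2) < s0 by rewrite gt_max; lra.
split; [lra|by rewrite ltr_norml; lra|apply: mclose_sym].
by apply: mclose_goursat => //; [lra|lra|apply/orP; right; lra].
Qed.

End CircularMeans.

(** * The Joukowski map, Bernstein ellipses and the Cauchy kernel *)

Section Joukowski.
Variable R : realType.
Local Notation C := R[i].
Local Notation nc := (@ComplexField.Normc.normc R).
Implicit Types (u v : C) (s t : R).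

(** The Joukowski map: circles of radius above 1 go to Bernstein ellipses, the unit circle to the
    interval from -1 to 1. *)
Definition jk u : C := (u + u^-1) / 2.

Lemma jkV u : jk u^-1 = jk u.
Proof. by rewrite /jk invrK addrC. Qed.

Lemma jkB u v : u != 0 -> v != 0 -> jk u - jk v = (u - v) * (1 - (u * v)^-1) / 2.
Proof. by move=> u0 v0; rewrite /jk; field; rewrite u0 v0. Qed.

Lemma jk_pol s t :
  jk (pol s t) = (bern_a (expR s) * cos t +i* (bern_b (expR s) * sin t))%C.
Proof.
have h2 : (2 : C)^-1 = (2^-1)%:C%C by rewrite fmorphV rmorph_nat.
rewrite /jk -polN h2 /pol cosN sinN expRN /bern_a /bern_b.
by apply/eqP; rewrite eq_complex/=; apply/andP; split; apply/eqP; ring.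
Qed.

Lemma bern_a_gt0 s : 0 < bern_a (expR s).
Proof. by rewrite /bern_a divr_gt0// addr_gt0 ?invr_gt0 ?expR_gt0. Qed.

Lemma bern_a_lt s s' : 0 <= s -> s < s' -> bern_a (expR s) < bern_a (expR s').
Proof.
move=> s0 ss'; rewrite /bern_a ltr_pM2r ?invr_gt0// -subr_gt0.
have e0 : 1 <= expR s by rewrite -expR0 ler_expR.
have e1 : expR s < expR s' by rewrite ltr_expR.
have -> : expR s' + (expR s')^-1 - (expR s + (expR s)^-1) =
  (expR s' - expR s) * (1 - (expR s * expR s')^-1).
  by field; rewrite !gt_eqF ?expR_gt0.
rewrite mulr_gt0 ?subr_gt0// invf_lt1 ?mulr_gt0 ?expR_gt0//.
by rewrite (le_lt_trans e0)// ltr_pMr ?expR_gt0// (le_lt_trans e0).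
Qed.

Lemma bern_b_gt0 s : 0 < s -> 0 < bern_b (expR s).
Proof.
move=> s0; rewrite /bern_b divr_gt0// subr_gt0.
have e1 : 1 < expR s by rewrite -expR0 ltr_expR.
by rewrite (lt_trans _ e1)// invf_lt1 ?expR_gt0.
Qed.

Lemma bern_b_lt s s' : s < s' -> bern_b (expR s) < bern_b (expR s').
Proof.
move=> ss'; rewrite /bern_b ltr_pM2r ?invr_gt0//.
have e1 : expR s < expR s' by rewrite ltr_expR.
have iv : (expR s')^-1 < (expR s)^-1 by rewrite ltf_pV2// posrE expR_gt0.
lra.
Qed.

Lemma bern_b_ge0 s : 0 <= s -> 0 <= bern_b (expR s).
Proof.
rewrite le_eqVlt => /orP[/eqP<-|/bern_b_gt0/ltW//].
by rewrite /bern_b expR0 invr1 subrr mul0r.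
Qed.

Lemma bern_q_jk L s t :
  bern_q (expR L) (jk (pol s t)) =
  (bern_a (expR s) / bern_a (expR L)) ^+ 2 * cos t ^+ 2 +
  (bern_b (expR s) / bern_b (expR L)) ^+ 2 * sin t ^+ 2.
Proof.
rewrite jk_pol /bern_q/=.
move: (bern_a _) (bern_a _) (bern_b _) (bern_b _) => a a' b b'.
by rewrite !exprMn !exprVn; congr (_ + _); rewrite mulrAC.
Qed.

Lemma bern_boundary_jk L t : 0 < L -> bern_boundary (expR L) (jk (pol L t)).
Proof.
move=> L0; rewrite /bern_boundary/= bern_q_jk !divff ?gt_eqF ?bern_a_gt0//.
  by rewrite expr1n !mul1r cos2Dsin2.
exact: bern_b_gt0.
Qed.

(** Both semi-axes grow strictly with the level, so the quadratic form is a convex combination, with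
    weights [cos t ^+ 2] and [sin t ^+ 2], of two numbers below 1. *)
Lemma bern_open_jk L s t : 0 <= s < L -> bern_open (expR L) (jk (pol s t)).
Proof.
move=> /andP[s0 sL]; rewrite /bern_open/= bern_q_jk.
set A := _ / _; set B := _ / _.
have A0 : 0 <= A by rewrite divr_ge0 ?ltW ?bern_a_gt0.
have A1 : A < 1 by rewrite ltr_pdivrMr ?bern_a_gt0// mul1r bern_a_lt.
have bL : 0 < bern_b (expR L) by rewrite bern_b_gt0// (le_lt_trans s0).
have B0 : 0 <= B by apply: divr_ge0; [exact: bern_b_ge0|exact: ltW].
have B1 : B < 1 by rewrite ltr_pdivrMr// mul1r bern_b_lt.
have c1 := cos2Dsin2 t; have c0 := sqr_ge0 (cos t); have d0 := sqr_ge0 (sin t).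
have A2 : A ^+ 2 < 1 by rewrite expr_lt1.
have B2 : B ^+ 2 < 1 by rewrite expr_lt1.
move: (A ^+ 2) (B ^+ 2) (cos t ^+ 2) (sin t ^+ 2) A2 B2 c1 c0 d0 => a b c d.
move=> a1 b1 cd c0 d0; have [dE|dp] := eqVneq d 0; first by rewrite dE (_ : c = 1); lra.
have {dp d0}dp : 0 < d by rewrite lt_def dp.
have : 0 < (1 - b) * d by rewrite mulr_gt0 ?subr_gt0.
have : 0 <= (1 - a) * c by rewrite mulr_ge0 ?subr_ge0// ltW.
lra.
Qed.

Lemma bern_closed_jk L s t : 0 < L -> 0 <= s <= L ->
  bern_closed (expR L) (jk (pol s t)).
Proof.
move=> L0 /andP[s0]; rewrite le_eqVlt => /orP[/eqP->|sL].
  by have := bern_boundary_jk t L0; rewrite /bern_boundary/bern_closed/= => ->.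
by have := @bern_open_jk L s t; rewrite s0 sL /= => /(_ isT) /ltW.
Qed.

Lemma bern_open_closed (rho : R) : bern_open rho `<=` bern_closed rho.
Proof. by move=> z /ltW. Qed.

(** Two points share a Joukowski image only if they are equal or mutually inverse. The first would
    give [s = s0], the second [s = - s0]. *)
Lemma jk_neq s0 t0 s t : 0 <= s0 -> 0 < s -> s != s0 ->
  jk (pol s t) != jk (pol s0 t0).
Proof.
move=> s00 s_gt0 ss0; rewrite -subr_eq0 jkB ?pol_neq0// !mulf_neq0//.
- rewrite subr_eq0; apply: contra ss0 => /eqP /(congr1 nc); rewrite !nc_pol.
  by move=> /expR_inj ->.
- rewrite -polD subr_eq0; apply/eqP => /(congr1 nc).
  rewrite nc1 -polN nc_pol => /eqP; rewrite -[1](@expR0 R) eq_sym => /eqP/expR_inj.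
  lra.
Qed.

Lemma derivable_jk u : u != 0 -> derivable jk u 1.
Proof.
move=> u0; apply: derivableC_mul; last exact: derivableC_cst.
by apply: derivableC_add; [exact: derivableC_id|apply: derivableC_inv => //; exact: derivableC_id].
Qed.

(** This is [u] times the derivative of [jk]: the weight that Cauchy's integral acquires when the
    ellipse is parametrized by the angle of [u]. *)
Definition jkd u : C := (u - u^-1) / 2.

Lemma jkdV u : jkd u^-1 = - jkd u.
Proof. by rewrite /jkd invrK -mulNr opprB. Qed.

Lemma derivable_jkd u : u != 0 -> derivable jkd u 1.
Proof.
move=> u0; rewrite /jkd (_ : (fun _ => _) = fun u => (u + (-1) * u^-1) / 2).
  apply: derivableC_mul; last exact: derivableC_cst.
  apply: derivableC_add; first exact: derivableC_id.
  apply: derivableC_mul; first exact: derivableC_cst.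
  by apply: derivableC_inv => //; exact: derivableC_id.
by apply/funext => w; rewrite mulN1r.
Qed.

(* With q = v/u and p = 1/(uv), the left-hand side is 1/(1-q) + 1/(1-p) - 1. *)
Lemma kernel_expansion m u v : u != 0 -> v != 0 -> v / u != 1 -> (u * v)^-1 != 1 ->
  jkd u / (jk u - jk v) =
  \sum_(k < m) u^-1 ^+ k * (v ^+ k + v^-1 ^+ k) - 1
  + ((v / u) ^+ m / (1 - v / u) + (u * v)^-1 ^+ m / (1 - (u * v)^-1)).
Proof.
move=> u0 v0 q1 p1; set q := v / u; set p := (u * v)^-1.
have geo (x : C) : x != 1 -> \sum_(k < m) x ^+ k = (1 - x ^+ m) / (1 - x).
  move=> x1; rewrite -opprB subrX1 -mulNr opprB mulrC.
  by rewrite mulKf// subr_eq0 eq_sym.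
have -> : \sum_(k < m) u^-1 ^+ k * (v ^+ k + v^-1 ^+ k) =
  \sum_(k < m) q ^+ k + \sum_(k < m) p ^+ k.
  rewrite -big_split; apply: eq_bigr => k _ /=.
  by rewrite mulrDr -!exprMn /q /p invfM [v / u]mulrC.
have q1' : 1 - q != 0 by rewrite subr_eq0 eq_sym.
have p1' : 1 - p != 0 by rewrite subr_eq0 eq_sym.
rewrite (geo q)// (geo p)//.
have uE : jkd u = u * (1 - q * p) / 2.
  by rewrite /jkd /q /p; field; rewrite u0 v0.
have vE : jk u - jk v = u * (1 - q) * (1 - p) / 2.
  by rewrite jkB// /q /p; field; rewrite u0 v0.
by rewrite uE vE; field; rewrite u0 q1' p1'.
Qed.

End Joukowski.

(** * Power means over roots of unity and geometric tails *)

Section GeometricTails.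
Variable R : realType.
Local Notation C := R[i].
Local Notation nc := (@ComplexField.Normc.normc R).

(** A geometric sum whose ratio [x] satisfies [x ^+ (2 ^ n) = 1]. The ratio is not 1: otherwise the
    sine of the half angle [y] would vanish, whereas [y] lies strictly between 0 and [pi]. *)
Lemma mean_pow (L : R) n l : (0 < l < 2 ^ n)%N ->
  \sum_(k < 2 ^ n) (pol L (k%:R * (pi *+ 2 / 2 ^+ n)))^-1 ^+ l = 0.
Proof.
move=> /andP[l0 ln]; set h := pi *+ 2 / 2 ^+ n.
have n0 : 0 < (2 ^+ n : R) by rewrite exprn_gt0.
pose x := pol 0 (- (l%:R * h)).
have E k : (pol L (k%:R * h))^-1 ^+ l = pol (- (l%:R * L)) 0 * x ^+ k.
  rewrite -polN polX /x polX -polD; congr pol; ring.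
rewrite (eq_bigr (fun k : 'I__ => pol (- (l%:R * L)) 0 * x ^+ k)) => [|k _]; last exact: E.
rewrite -mulr_sumr; have x1 : x - 1 != 0.
  rewrite subr_eq0 /x /pol expR0 mul1r cosN; apply/eqP => /(congr1 (@complex.Re _)) /=.
  pose y : R := l%:R * pi / 2 ^+ n.
  have -> : l%:R * h = y *+ 2 by rewrite /h /y -!mulrnAr; ring.
  rewrite cos_mulr2n cos2sin2 => yE.
  have : 0 < sin y.
    apply: sin_gt0_pi; rewrite /y divr_gt0 ?mulr_gt0 ?pi_gt0 ?ltr0n//=.
    rewrite ltr_pdivrMr// mulrC ltr_pM2l ?pi_gt0//.
    by rewrite -natrX ltr_nat.
  have : sin y ^+ 2 = 0 by move: yE; rewrite mulr2n; lra.
  by move/eqP; rewrite sqrf_eq0 => /eqP ->; rewrite ltxx.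
have xN : x ^+ (2 ^ n) = 1.
  have -> : x ^+ (2 ^ n) = (pol 0 (l%:R * (pi *+ 2)))^-1.
    rewrite /x polX -polN mulr0 oppr0 natrX /h; congr pol.
    by field; rewrite gt_eqF.
  have -> : pol 0 (l%:R * (pi *+ 2)) = 1 :> C; last by rewrite invr1.
  elim: (l) => [|i ih]; first by rewrite mul0r pol0.
  by rewrite -natr1 mulrDl mul1r pol_2pi.
have : (x - 1) * \sum_(k < 2 ^ n) x ^+ k = 0 by rewrite -subrX1 xN subrr.
by move/eqP; rewrite mulf_eq0 (negPf x1) => /eqP ->; rewrite mulr0.
Qed.

Lemma tail_le (x : C) r m : nc x <= r -> r < 1 ->
  nc (x ^+ m / (1 - x)) <= r ^+ m / (1 - r).
Proof.
move=> xr r1; rewrite ncM ncV ncX.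
have h : 1 - r <= nc (1 - x).
  have := ncD (1 - x) x; rewrite subrK nc1; lra.
apply: ler_pM; rewrite ?exprn_ge0 ?invr_ge0 ?nc_ge0//.
  by rewrite lerXn2r ?nnegrE ?nc_ge0// (le_trans (nc_ge0 x)).
by rewrite lef_pV2// posrE; lra.
Qed.

Lemma pow_small (r B e : R) : 0 <= r < 1 -> 0 < e -> exists N, forall n,
  (N <= n)%N -> r ^+ (2 ^ n) * B <= e.
Proof.
move=> /andP[r0 r1] e0.
have [B0|B0] := leP B 0.
  exists 0%N => n _; rewrite (@le_trans _ _ 0) ?(ltW e0)//.
  by rewrite mulr_ge0_le0// exprn_ge0.
have := @cvg_expr R r; rewrite ger0_norm// => /(_ r1) /cvgrPdist_le /(_ (e / B)).
rewrite divr_gt0// => /(_ isT) [N _ hN]; exists N => n Nn.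
rewrite -ler_pdivlMr//; have := hN n Nn; rewrite /= sub0r normrN ger0_norm ?exprn_ge0//.
by apply: le_trans; apply: ler_wiXn2l => //; [exact: ltW|exact/ltnW/ltn_expl].
Qed.

End GeometricTails.

(** * Cauchy's formula as a limit of means, and bounds for functionals *)

Section CauchyMean.
Variable R : realType.
Local Notation C := R[i].
Local Notation nc := (@ComplexField.Normc.normc R).
Variables (f : C -> C) (L : R).
Hypothesis L0 : 0 < L.
Hypothesis fC : {within bern_closed (expR L), continuous f}.
Hypothesis fD : forall z, bern_open (expR L) z -> derivable f z 1.

Section Slope.
Variables (s0 t0 : R).
Hypothesis s0L : 0 <= s0 < L.
Let v := pol s0 t0.
Let z := jk v.

(** The difference quotient of [f] at [z], completed at [z] by the derivative. There only continuity
    is claimed, which is what [cmean_vanish] asks at the singular level. *)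
Lemma slope_exists : exists D : C -> C,
  [/\ forall w, w != z -> D w = (f w - f z) / (w - z),
     forall w, bern_closed (expR L) w -> forall e : R, 0 < e ->
       exists2 d : R, 0 < d & forall w', bern_closed (expR L) w' ->
         nc (w' - w) < d -> nc (D w' - D w) < e &
     forall w, w != z -> bern_open (expR L) w -> derivable D w 1].
Proof.
have zo : bern_open (expR L) z by exact: bern_open_jk.
have [a ha] := derivable_nc (fD zo).
pose D w := if w == z then a else (f w - f z) / (w - z).
have DE w : w != z -> D w = (f w - f z) / (w - z) by rewrite /D => /negPf ->.
have near_neq w : w != z -> \forall w' \near w, w' != z.
  move=> wz; apply/near_nc; exists (nc (w - z)); first by rewrite nc_gt0 subr_eq0.
  by move=> w'; apply: contraTneq => ->; rewrite ncBC ltxx.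
exists D; split => //.
- move=> w wc e e0; have [->{w wc}|wz] := eqVneq w z.
    have e20 : 0 < e / 2 by rewrite divr_gt0.
    have [d d0 hd] := ha _ e20; exists d => // w _ wz.
    have [->|wnz] := eqVneq w z; first by rewrite subrr nc0.
    rewrite DE// (_ : D z = a); last by rewrite /D eqxx.
    have := hd w wz.
    have wz0 : 0 < nc (w - z) by rewrite nc_gt0 subr_eq0.
    have -> : f w - f z - a * (w - z) = ((f w - f z) / (w - z) - a) * (w - z).
      by rewrite mulrBl divfK// subr_eq0.
    by rewrite ncM ler_pM2r//; lra.
  have fw : f x @[x --> within (bern_closed (expR L)) (nbhs w)] --> f w.
    by move/subspace_continuousP : fC; apply.
  have FF : Filter (within (bern_closed (expR L)) (nbhs w)).
    exact: within_filter (nbhs_filter w).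
  have iw : x @[x --> within (bern_closed (expR L)) (nbhs w)] --> w.
    by apply: cvg_trans; [exact: cvg_within|exact: cvg_id].
  have c1 := @cvgB C C _ _ FF f (fun=> f z) _ _ fw (@cvg_cst _ _ _ _ FF).
  have c2 := @cvgB C C _ _ FF id (fun=> z) _ _ iw (@cvg_cst _ _ _ _ FF).
  have wz0 : w - z != 0 by rewrite subr_eq0.
  have c3 := @cvgM C _ _ FF _ _ _ _ c1 (@cvgV C _ _ FF _ _ wz0 c2).
  have /(_ e e0) := (@cvg_nc _ _ _ _ _ FF).1 c3.
  rewrite near_withinE => h.
  have [d d0 hd] := (@near_nc R w _).1 (filterI h (near_neq w wz)).
  by exists d => // w' w'c /hd[h1 h2]; rewrite !DE//; exact: h1.
- move=> w wz wo.
  apply: (@derivableC_near_eq _ (fun w => (f w + (- f z)) * (w + (- z))^-1)).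
    by apply: filterS (near_neq w wz) => w' w'z; rewrite DE.
  apply: derivableC_mul; first by apply: derivableC_add; [exact: fD|exact: derivableC_cst].
  apply: derivableC_inv; first by rewrite subr_eq0.
  by apply: derivableC_add; [exact: derivableC_id|exact: derivableC_cst].
Qed.

(** Cauchy's theorem for the slope. The integrand is odd on the unit circle since inversion fixes
    [jk] and negates [jkd], and by [jk_neq] it meets [z] at no positive level other than [s0]. *)
Lemma cauchy_mean0 (e : R) : 0 < e -> exists N, forall n, (N <= n)%N ->
  nc (cmean (fun s t => (f (jk (pol s t)) - f z) / (jk (pol s t) - z)
                        * jkd (pol s t)) n L) <= e.
Proof.
move=> e0; have [D [DE DC DD]] := slope_exists.
pose F s t := D (jk (pol s t)) * jkd (pol s t).
have s00 : 0 <= s0 by case/andP: s0L.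
have FE n : cmean (fun s t => (f (jk (pol s t)) - f z) / (jk (pol s t) - z)
                        * jkd (pol s t)) n L = cmean F n L.
  rewrite /cmean; congr (_ * _); apply: eq_bigr => k _; rewrite /F DE//.
  by apply: jk_neq => //; case/andP: s0L => _; rewrite lt_neqAle eq_sym => /andP[].
suff [N hN] : exists N, forall n, (N <= n)%N -> nc (cmean F n L) <= e.
  by exists N => n; rewrite FE; exact: hN.
apply: (@cmean_vanish R F L s0) => //.
- move=> s t hs e' e'0.
  have wc : bern_closed (expR L) (jk (pol s t)) by exact: bern_closed_jk.
  pose A := nc (D (jk (pol s t))); pose B := nc (jkd (pol s t)).
  have A0 : 0 <= A := nc_ge0 _.
  have B0 : 0 <= B := nc_ge0 _.
  have eA : 0 < Num.min 1 (e' / (2 * (A + 1))).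
    by rewrite lt_min ltr01 divr_gt0// mulr_gt0// ltr_wpDl.
  have eB : 0 < e' / (2 * (B + 1)) by rewrite divr_gt0// mulr_gt0// ltr_wpDl.
  have [d1 d10 h1] := DC _ wc _ eB.
  have [d2 d20 h2] := cdiff2_continuous
    (cdiff2_pol (derivable_jk (pol_neq0 s t))) d10.
  have [d3 d30 h3] := cdiff2_continuous
    (cdiff2_pol (derivable_jkd (pol_neq0 s t))) eA.
  exists (Num.min d2 d3); first by rewrite lt_min d20.
  move=> s' t' hs'; rewrite !lt_min => /andP[sd2 sd3] /andP[td2 td3].
  have k1 := h1 _ (bern_closed_jk t' L0 hs') (h2 _ _ sd2 td2).
  have := h3 _ _ sd3 td3; rewrite lt_min => /andP[k2 k3].
  have -> : F s' t' - F s t =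
    (D (jk (pol s' t')) - D (jk (pol s t))) * jkd (pol s' t')
    + D (jk (pol s t)) * (jkd (pol s' t') - jkd (pol s t)) by rewrite /F; ring.
  have k4 : nc (jkd (pol s' t')) <= B + 1.
    have -> : jkd (pol s' t') = jkd (pol s t) + (jkd (pol s' t') - jkd (pol s t)).
      by rewrite addrC subrK.
    by apply: (le_trans (ncD _ _)); rewrite lerD2l ltW.
  apply: (le_lt_trans (ncD _ _)); rewrite (ncM (_ - _)) (ncM (D _)) -/A.
  have B1 : 0 < B + 1 by rewrite ltr_wpDl.
  have A1 : 0 < A + 1 by rewrite ltr_wpDl.
  have k5 : nc (D (jk (pol s' t')) - D (jk (pol s t))) * nc (jkd (pol s' t'))
      <= nc (D (jk (pol s' t')) - D (jk (pol s t))) * (B + 1).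
    by rewrite ler_wpM2l ?nc_ge0.
  have k6 : nc (D (jk (pol s' t')) - D (jk (pol s t))) * (B + 1) < e' / 2.
    by rewrite -ltr_pdivlMr//; move: k1; rewrite invfM mulrA.
  have k7 : A * nc (jkd (pol s' t') - jkd (pol s t)) <= e' / 2.
    apply: (@le_trans _ _ ((A + 1) * nc (jkd (pol s' t') - jkd (pol s t)))).
      by rewrite ler_wpM2r ?nc_ge0// lerDl.
    by rewrite mulrC -ler_pdivlMr//; move: k3; rewrite invfM mulrA => /ltW.
  by rewrite (splitr e') ltr_leD// (le_lt_trans k5).
- move=> s t /andP[s_gt0 sL] ss0.
  apply: (@cdiff2_pol _ (fun u => D (jk u) * jkd u)).
  apply: derivableC_mul; last exact/derivable_jkd/pol_neq0.
  have DJ : derivable D (jk (pol s t)) 1.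
    apply: DD; first exact: jk_neq.
    by apply: bern_open_jk; rewrite sL ltW.
  exact: derivableC_comp DJ (derivable_jk (pol_neq0 s t)).
- by move=> s t; rewrite /F pol_2pi.
- move=> t; rewrite /F; have -> : pol 0 (- t) = (pol 0 t)^-1 by rewrite -polN oppr0.
  by rewrite jkV jkdV mulrN.
Qed.


(** Write [f] as its slope part plus the constant [f z]. The slope part has vanishing mean, and the
    kernel has mean 1 up to tails of order [r ^+ (2 ^ n)]. *)
Lemma cauchy_mean (e : R) : 0 < e -> exists N, forall n, (N <= n)%N ->
  nc (f z - cmean (fun s t => f (jk (pol s t)) * (jkd (pol s t) / (jk (pol s t) - z))) n L)
    <= e.
Proof.
move=> e0; have e20 : 0 < e / 2 by rewrite divr_gt0.
have [s00 sL] := andP s0L.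
(* This is the modulus of [v / u k]; that of [(u k * v)^-1] is at most [r] because [s0] is
   nonnegative. *)
pose r := expR (s0 - L).
have r01 : 0 <= r < 1 by rewrite expR_ge0/= -expR0 ltr_expR; lra.
have [N1 hN1] := cauchy_mean0 e20.
have [N2 hN2] := pow_small (nc (f z) * (2 / (1 - r))) r01 e20.
exists (N1 + N2)%N => n hn.
have {hN1}k1 := hN1 n (leq_trans (leq_addr _ _) hn).
have {hN2}k2 := hN2 n (leq_trans (leq_addl _ _) hn).
pose h : R := pi *+ 2 / 2 ^+ n; pose u (k : 'I_(2 ^ n)) := pol L (k%:R * h).
have n0 : (2 ^+ n : C) != 0 by rewrite expf_neq0.
pose T (k : 'I_(2 ^ n)) := (v / u k) ^+ (2 ^ n) / (1 - v / u k)
   + (u k * v)^-1 ^+ (2 ^ n) / (1 - (u k * v)^-1).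
have nq k : nc (v / u k) = r.
  by rewrite ncM ncV !nc_pol /r expRD expRN.
have np k : nc (u k * v)^-1 <= r.
  by rewrite -polD -polN nc_pol ler_expR; lra.
have [r0 r1] := andP r01.
have q1 k : v / u k != 1.
  by apply/eqP => /(congr1 nc); rewrite nq nc1 => rE; move: r1; rewrite rE ltxx.
have p1 k : (u k * v)^-1 != 1.
  by apply/eqP => pE; have := np k; rewrite pE nc1 leNgt r1.
have KE k : jkd (u k) / (jk (u k) - z) =
  \sum_(l < 2 ^ n) (u k)^-1 ^+ l * (v ^+ l + v^-1 ^+ l) - 1 + T k.
  by apply: kernel_expansion; rewrite ?pol_neq0.
have meanK : (2 ^+ n)^-1 * \sum_k (jkd (u k) / (jk (u k) - z)) =
    1 + (2 ^+ n)^-1 * \sum_k T k.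
  (* The expansion is cut at [2 ^ n], so every power with [l > 0] averages to zero by [mean_pow].
     The term [l = 0] contributes 2, and the [- 1] leaves 1. *)
  under eq_bigr do rewrite KE.
  rewrite big_split/= mulrDr; congr (_ + _).
  rewrite sumrB exchange_big/= sumr_const card_ord -natrX in n0 *.
  have N0 : (0 < 2 ^ n)%N by rewrite expn_gt0.
  rewrite (bigD1 (Ordinal N0))//= [X in _ + X - _]big1 => [|l l0]; last first.
    rewrite -mulr_suml mean_pow ?mul0r// ltn_ord andbT lt0n.
    by apply: contra l0 => /eqP l0; apply/eqP/val_inj.
  under eq_bigr do rewrite !expr0 mul1r.
  rewrite sumr_const card_ord addr0 mulrnDl addrK.
  by rewrite mulVf.
have E : f z - cmean (fun s t => f (jk (pol s t)) * (jkd (pol s t) / (jk (pol s t) - z))) n L =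
  - (f z * ((2 ^+ n)^-1 * \sum_k T k))
  - cmean (fun s t => (f (jk (pol s t)) - f z) / (jk (pol s t) - z)
                        * jkd (pol s t)) n L.
  have -> : f z * ((2 ^+ n)^-1 * \sum_k T k) =
    f z * ((2 ^+ n)^-1 * \sum_k (jkd (u k) / (jk (u k) - z))) - f z.
    by rewrite meanK mulrDr mulr1 [f z + _]addrC addrK.
  rewrite /cmean -/h.
  have -> : \sum_(k < 2 ^ n) (f (jk (pol L (k%:R * h))) - f z)
       / (jk (pol L (k%:R * h)) - z) * jkd (pol L (k%:R * h)) =
    \sum_k f (jk (u k)) * (jkd (u k) / (jk (u k) - z))
    - f z * \sum_k (jkd (u k) / (jk (u k) - z)).
    rewrite mulr_sumr -sumrB; apply: eq_bigr => k _; rewrite -/(u k); ring.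
  by rewrite /u; ring.
rewrite E; apply: (le_trans (ncB _ _)); rewrite ncN.
suff : nc (f z * ((2 ^+ n)^-1 * \sum_k T k)) <= r ^+ (2 ^ n) * (nc (f z) * (2 / (1 - r))).
  lra.
rewrite ncM mulrCA ler_wpM2l ?nc_ge0// ncM ncV ncX nc_nat.
rewrite mulrC ler_pdivrMr ?exprn_gt0//.
apply: (le_trans (nc_sum _ _ _)).
have -> : r ^+ (2 ^ n) * (2 / (1 - r)) * 2 ^+ n =
    \sum_(k < 2 ^ n) (r ^+ (2 ^ n) * (2 / (1 - r))).
  by rewrite sumr_const card_ord -[RHS]mulr_natr natrX.
apply: ler_sum => k _; apply: (le_trans (ncD _ _)).
have nq' : nc (v / u k) <= r by rewrite nq.
have t1 := tail_le (2 ^ n) nq' r1.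
have t2 := tail_le (2 ^ n) (np k) r1.
rewrite (_ : r ^+ (2 ^ n) * (2 / (1 - r)) = r ^+ (2 ^ n) / (1 - r) + r ^+ (2 ^ n) / (1 - r)).
  exact: lerD.
by ring.
Qed.

End Slope.

(** Under Cauchy's formula the functional acts on the kernels. Orthogonality to [v ^+ k + v^-1 ^+ k]
    for [k < m] removes the head of each expansion; the two geometric tails remain, weighted by
    boundary values of [f]. *)
Lemma functional_bound (J : finType) (c : J -> C) (s t : J -> R) m (ka : R) :
  (0 < m)%N -> (forall j, 0 <= s j < L) ->
  (forall k, (k < m)%N ->
     \sum_j c j * (pol (s j) (t j) ^+ k + (pol (s j) (t j))^-1 ^+ k) = 0) ->
  (forall w, bern_boundary (expR L) w -> nc (f w) <= ka) ->
  nc (\sum_j c j * f (jk (pol (s j) (t j)))) <=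
  ka * \sum_j nc (c j) * (expR (s j - L) ^+ m / (1 - expR (s j - L))
                        + expR (- s j - L) ^+ m / (1 - expR (- s j - L))).
Proof.
move=> m0 sL orth fka; apply/ler_addgt0Pr => e e0.
pose v j := pol (s j) (t j); pose w j := jk (v j).
pose B := \sum_j nc (c j).
have B0 : 0 <= B by apply: sumr_ge0 => j _; exact: nc_ge0.
have e'0 : 0 < e / (B + 1) by rewrite divr_gt0// ltr_wpDl.
have [N hN] := choice (fun j => cauchy_mean (t j) (sL j) e'0).
(* One level fine enough for all points, so that their means share the sample points [u k]. *)
pose n := \max_j N j.
have {}hN j := hN j n (leq_bigmax j).
pose h : R := pi *+ 2 / 2 ^+ n; pose u (k : 'I_(2 ^ n)) := pol L (k%:R * h).
pose K j k := jkd (u k) / (jk (u k) - w j).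
pose T j k := (v j / u k) ^+ m / (1 - v j / u k)
   + (u k * v j)^-1 ^+ m / (1 - (u k * v j)^-1).
have nq j k : nc (v j / u k) = expR (s j - L).
  by rewrite ncM ncV !nc_pol expRD expRN.
have np j k : nc (u k * v j)^-1 = expR (- s j - L).
  by rewrite -polD -polN nc_pol; congr expR; ring.
have q1 j k : v j / u k != 1.
  apply/eqP => /(congr1 nc); rewrite nq nc1 -[1](@expR0 R) => /expR_inj.
  by have := sL j; lra.
have p1 j k : (u k * v j)^-1 != 1.
  apply/eqP => /(congr1 nc); rewrite np nc1 -[1](@expR0 R) => /expR_inj.
  by have := sL j; lra.
(* The case [k = 0] of orthogonality; it disposes of the [- 1] in the kernel expansion. *)
have c0 : \sum_j c j = 0.
  have := orth 0%N m0; under eq_bigr do rewrite !expr0.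
  rewrite -mulr_suml => /eqP; rewrite mulf_eq0 -[1 + 1]/(2%:R) pnatr_eq0 orbF.
  by move/eqP.
have cK k : \sum_j c j * K j k = \sum_j c j * T j k.
  have KE j : K j k = \sum_(l < m) (u k)^-1 ^+ l * (v j ^+ l + (v j)^-1 ^+ l) - 1 + T j k.
    by apply: kernel_expansion; rewrite ?pol_neq0.
  under eq_bigr do rewrite KE mulrDr mulrBr mulr1.
  rewrite big_split sumrB c0 subr0/= -[RHS]add0r; congr (_ + _).
  under eq_bigr do rewrite mulr_sumr.
  rewrite exchange_big big1//= => l _.
  under eq_bigr do rewrite mulrCA.
  by rewrite -mulr_sumr orth// mulr0.
pose S j := cmean (fun s t => f (jk (pol s t)) * (jkd (pol s t) / (jk (pol s t) - w j))) n L.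
have -> : \sum_j c j * f (w j) =
  \sum_j c j * (f (w j) - S j) + \sum_j c j * S j.
  by rewrite -big_split; apply: eq_bigr => j _ /=; rewrite -mulrDr subrK.
apply: (le_trans (ncD _ _)); rewrite addrC lerD//; last first.
  apply: (le_trans (nc_sum _ _ _)).
  apply: (@le_trans _ _ (\sum_j nc (c j) * (e / (B + 1)))).
    by apply: ler_sum => j _; rewrite ncM ler_wpM2l ?nc_ge0//; exact: hN.
  rewrite -mulr_suml -/B mulrCA ger_pMr// ler_pdivrMr ?ltr_wpDl// mul1r.
  by rewrite lerDl.
have -> : \sum_j c j * S j = (2 ^+ n)^-1 * \sum_k f (jk (u k)) * \sum_j c j * T j k.
  rewrite /S /cmean; under eq_bigr do rewrite mulrCA mulr_sumr.
  rewrite -mulr_sumr exchange_big/=; congr (_ * _); apply: eq_bigr => k _.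
  by rewrite -cK mulr_sumr; apply: eq_bigr => j _; rewrite mulrCA.
rewrite ncM ncV ncX nc_nat mulrC ler_pdivrMr ?exprn_gt0//.
apply: (le_trans (nc_sum _ _ _)).
set X := \sum_j _ * (_ + _).
have -> : ka * X * 2 ^+ n = \sum_(k < 2 ^ n) ka * X.
  by rewrite sumr_const card_ord -[RHS]mulr_natr natrX.
apply: ler_sum => k _; rewrite ncM; apply: ler_pM; rewrite ?nc_ge0//.
  exact/fka/bern_boundary_jk.
apply: (le_trans (nc_sum _ _ _)); apply: ler_sum => j _.
rewrite ncM ler_wpM2l ?nc_ge0// (le_trans (ncD _ _))// lerD//.
  by apply: tail_le; rewrite ?nq// -expR0 ltr_expR; have := sL j; lra.
by apply: tail_le; rewrite ?np// -expR0 ltr_expR; have := sL j; lra.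
Qed.

End CauchyMean.

(** * Chebyshev polynomials *)

Section Chebyshev.
Variable R : realType.
Local Notation C := R[i].

(** Consecutive polynomials are carried as a pair, so that the three-term recurrence becomes
    structural. *)
Fixpoint cheb2 n : {poly R} * {poly R} :=
  if n is m.+1 then let: (p, q) := cheb2 m in (q, 2%:P * 'X * q - p)
  else (1, 'X).

Definition cheb n := (cheb2 n).1.

Lemma cheb2E n : cheb2 n = (cheb n, cheb n.+1).
Proof. by rewrite /cheb/=; case: (cheb2 n). Qed.

Lemma chebSS n : cheb n.+2 = 2%:P * 'X * cheb n.+1 - cheb n.
Proof. by rewrite {1}/cheb/= !cheb2E/=; congr (_ - _); rewrite /cheb/= cheb2E. Qed.

Lemma size_cheb n : (size (cheb n) <= n.+1)%N.
Proof.
suff : (size (cheb n) <= n.+1)%N /\ (size (cheb n.+1) <= n.+2)%N by case.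
elim: n => [|n [ih1 ih2]]; first by rewrite /cheb/= size_poly1 size_polyX.
split=> //; rewrite chebSS (leq_trans (size_polyD _ _))// geq_max size_polyN.
rewrite (leq_trans ih1) ?andbT; last by lia.
rewrite -mulrA mul_polyC (leq_trans (size_scale_leq _ _))//.
by rewrite (leq_trans (size_polyMleq _ _))// size_polyX.
Qed.

(** Both sides satisfy the same three-term recurrence, since [2 t = v + v^-1]. *)
Lemma cheb_jk n (t : R) (v : C) : v != 0 -> t%:C%C = jk v ->
  2 * ((cheb n).[t])%:C%C = v ^+ n + v^-1 ^+ n.
Proof.
move=> v0 tv.
suff : 2 * ((cheb n).[t])%:C%C = v ^+ n + v^-1 ^+ n /\
       2 * ((cheb n.+1).[t])%:C%C = v ^+ n.+1 + v^-1 ^+ n.+1 by case.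
have tv2 : 2 * t%:C%C = v + v^-1 by rewrite tv /jk mulrC divfK// pnatr_eq0.
elim: n => [|n [ih1 ih2]].
  by rewrite /cheb/= hornerC hornerX !expr0 !expr1 tv2 rmorph1 mulr1.
split=> //; rewrite chebSS !hornerE !rmorphB !rmorphM rmorph_nat mulrBr ih1 tv2.
by rewrite mulrCA ih2 !exprS; field.
Qed.

Lemma cheb_cos n x : (cheb n).[cos x] = cos (n%:R * x).
Proof.
have := @cheb_jk n (cos x) (pol 0 x) (pol_neq0 0 x).
rewrite jk_pol expR0 /bern_a /bern_b invr1 subrr mul0r mul0r.
have -> : ((1 + 1) / 2 : R) = 1 by rewrite divff.
rewrite mul1r => /(_ erefl); rewrite exprVn polX -polN mulr0 oppr0.
move=> /(congr1 (@complex.Re R)); rewrite /pol expR0 !mul1r cosN.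
by rewrite -(rmorph_nat (real_complex R)) -rmorphM/=; lra.
Qed.

(** Here [t] is the Joukowski image of [tau >= 1], so the value is the average of [tau ^+ n] and the
    smaller [tau^-1 ^+ n]. *)
Lemma cheb_le n t : 1 <= t ->
  (cheb n).[t] <= (t + Num.sqrt (t ^+ 2 - 1)) ^+ n.
Proof.
move=> t1; set tau := t + _.
have st : Num.sqrt (t ^+ 2 - 1) ^+ 2 = t ^+ 2 - 1.
  by rewrite sqr_sqrtr// subr_ge0 expr_ge1// (le_trans ler01).
have tau1 : 1 <= tau by rewrite (le_trans t1)// lerDl sqrtr_ge0.
have tau0 : tau != 0 by rewrite gt_eqF// (lt_le_trans ltr01).
have tE : t = (tau + tau^-1) / 2.
  have -> : tau^-1 = t - Num.sqrt (t ^+ 2 - 1).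
    apply: (mulfI tau0); rewrite mulfV// /tau mulrC -subr_sqr st; ring.
  by rewrite /tau; field.
have := @cheb_jk n t tau%:C%C; rewrite fmorph_eq0 => /(_ tau0).
rewrite {1}tE rmorphM rmorphD !fmorphV rmorph_nat => /(_ erefl).
rewrite -(fmorphV (real_complex R)) -!(rmorphXn (real_complex R)).
rewrite -(rmorphD (real_complex R)) -(rmorph_nat (real_complex R)).
rewrite -(rmorphM (real_complex R)) => /complexI h.
have : tau^-1 ^+ n <= tau ^+ n.
  rewrite (@le_trans _ _ 1)// ?exprn_ege1// exprn_ile1 ?invr_ge0 ?invf_le1//.
    by rewrite (le_trans ler01).
  by rewrite (lt_le_trans ltr01).
lra.
Qed.

Lemma sin_mul_le n (x : R) : `|sin (n%:R * x)| <= n%:R * `|sin x|.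
Proof.
elim: n => [|n ih]; first by rewrite !mul0r sin0 normr0.
rewrite -natr1 mulrDl mul1r sinD (le_trans (ler_normD _ _))// mulrDl mul1r.
rewrite !normrM lerD// ?ler_piMl ?cos_max//.
by rewrite (le_trans _ ih)// ler_piMr ?cos_max.
Qed.

Lemma cosB_prod (a b : R) :
  cos a - cos b = - (2 * sin ((a + b) / 2) * sin ((a - b) / 2)).
Proof.
have -> : cos a = cos ((a + b) / 2 + (a - b) / 2) by congr cos; field.
have -> : cos b = cos ((a + b) / 2 - (a - b) / 2) by congr cos; field.
by rewrite cosD cosB; ring.
Qed.

(** Markov's bound without derivatives: both differences of cosines become products of sines, and
    each of the two sines loses a factor [n] by [sin_mul_le]. *)
Lemma cheb_lip n (x y : R) : -1 <= x <= 1 -> -1 <= y <= 1 ->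
  `|(cheb n).[x] - (cheb n).[y]| <= n%:R ^+ 2 * `|x - y|.
Proof.
move=> hx hy; rewrite -(acosK (x := x)) ?in_itv// -(acosK (x := y)) ?in_itv//.
move: (acos x) (acos y) => a b; rewrite !cheb_cos !cosB_prod !normrN !normrM.
rewrite -mulrDr -mulrBr -!mulrA normr_nat.
have -> : n%:R * (n%:R * (2 * (`|sin ((a + b) / 2)| * `|sin ((a - b) / 2)|))) =
  2 * ((n%:R * `|sin ((a + b) / 2)|) * (n%:R * `|sin ((a - b) / 2)|)) by ring.
by rewrite ler_pM2l// ler_pM// sin_mul_le.
Qed.

End Chebyshev.

(** * Stable extrapolation from the time grid *)

Section Extrapolation.
Variable R : realType.

(** Lagrange's formula at [t]. The nodes form an infinite sequence because injectivity is required
    on all of [nat]. *)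
Lemma lagrange_eval n (x : nat -> R) (p : {poly R}) (t : R) :
  {homo x : i j / (i < j)%N >-> j < i} -> (size p <= n.+1)%N ->
  p.[t] = \sum_(k < n.+1) p.[x k] *
    ((\prod_(j < n.+1 | j != k) (t - x j)) / \prod_(j < n.+1 | j != k) (x k - x j)).
Proof.
move=> xdec sp; have xinj : injective x.
  move=> i j xij; case: (ltngtP i j) => // /xdec; rewrite xij ltxx//.
rewrite {1}(lagrange_gen (ltn0Sn n) xinj sp) horner_sum; apply: eq_bigr => k _.
rewrite hornerM hornerC; congr (_ * _).
rewrite lagrangeE// hornerM hornerC !horner_prod mulrC; congr (_ * _).
  by apply: eq_bigr => j _; rewrite hornerXsubC.
by congr (_^-1); apply: eq_bigr => j _; rewrite hornerXsubC.
Qed.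

(** The numerator is positive as [t] lies to the right of all nodes; in the denominator exactly the
    [k] factors with [j < k] are negative. *)
Lemma lagrange_sign n (x : nat -> R) (t : R) (k : 'I_n.+1) :
  {homo x : i j / (i < j)%N >-> j < i} -> (forall j : 'I_n.+1, x j < t) ->
  0 < (-1) ^+ k * ((\prod_(j < n.+1 | j != k) (t - x j)) /
                   \prod_(j < n.+1 | j != k) (x k - x j)).
Proof.
move=> xdec xt; have N0 : 0 < \prod_(j < n.+1 | j != k) (t - x j).
  by apply: prodr_gt0 => j _; rewrite subr_gt0.
rewrite mulrCA pmulr_rgt0//.
rewrite (bigID (fun j : 'I_n.+1 => (j < k)%N))/=.
have -> : \prod_(j < n.+1 | (j != k) && (j < k)%N) (x k - x j) =
    (-1) ^+ k * \prod_(j < n.+1 | (j < k)%N) (x j - x k).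
  have kn : (k <= n.+1)%N by exact: ltnW.
  rewrite (eq_bigl (fun j : 'I_n.+1 => (j < k)%N)) => [|j]; last first.
    by rewrite andbC andb_idr// => jk; apply: contraTneq jk => ->; rewrite ltnn.
  rewrite !(big_ord_narrow kn) (eq_bigr (fun j : 'I_k => - (x j - x k))).
    by rewrite prodrN card_ord.
  by move=> j _ /=; rewrite opprB.
set P := \prod_(j < n.+1 | (j < k)%N) _; set Q := \prod_(j < n.+1 | _ && _) _.
have P0 : 0 < P by apply: prodr_gt0 => j jk; rewrite subr_gt0 xdec.
have Q0 : 0 < Q.
  apply: prodr_gt0 => j /andP[jk]; rewrite -leqNgt leq_eqVlt eq_sym.
  by rewrite val_eqE (negPf jk)/= => kj; rewrite subr_gt0 xdec.
have -> : (-1) ^+ k / ((-1) ^+ k * P * Q) = (P * Q)^-1.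
  by field; rewrite signr_eq0 !gt_eqF.
by rewrite invr_gt0 mulr_gt0.
Qed.

Lemma extrap_coefs M Rk : (2 <= M)%N ->
  (Rk%:R : R) <= Num.sqrt (M%:R - 1) / 2 ->
  exists c : 'I_M -> R,
    (forall p : {poly R}, (size p <= Rk.+1)%N ->
       \sum_j c j * p.[tpast R M j] = p.[tnext R M]) /\
    \sum_j `|c j| <=
      2 * (tnext R M + Num.sqrt (tnext R M ^+ 2 - 1)) ^+ Rk.
Proof.
move=> M2 hR; set h := dt R M; set t := tnext R M.
have M1 : 0 < M%:R - 1 :> R by rewrite subr_gt0 ltr1n.
have h0 : 0 < h by rewrite divr_gt0.
have Mh : (M%:R - 1) * h = 2 by rewrite /h /dt mulrC divfK// gt_eqF.
(* From [Rk ^+ 2 <= (M - 1) / 4] and [(M - 1) * h = 2]: moving a node by at most [h] changes the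
   Chebyshev value by at most 1/2. *)
have Rh : Rk%:R ^+ 2 * h <= 2^-1.
  have : Rk%:R ^+ 2 <= (M%:R - 1) / 4 :> R.
    rewrite (@le_trans _ _ ((Num.sqrt (M%:R - 1) / 2) ^+ 2))//.
      by rewrite lerXn2r ?nnegrE ?divr_ge0 ?sqrtr_ge0.
    have -> : (Num.sqrt (M%:R - 1) / 2) ^+ 2 = Num.sqrt (M%:R - 1) ^+ 2 / 4 :> R.
      by field.
    by rewrite sqr_sqrtr// ltW.
  have E : (M%:R - 1) / 4 * h = 2^-1 by rewrite mulrAC Mh; field.
  by move=> /(ler_wpM2r (ltW h0)); rewrite E.
(* The Chebyshev extrema in decreasing order. For [Rk = 0] the quotient is 0 by convention and the
   single node is 1. *)
pose xi (j : nat) : R := cos (j%:R * (pi / Rk%:R)).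
(* Index of the grid point obtained by rounding [xi j] down. *)
pose g (j : nat) := Num.truncn ((xi j + 1) / h).
have xi1 j : -1 <= xi j <= 1 by rewrite cos_geN1 cos_le1.
have xj j : 0 <= (xi j + 1) / h.
  by apply: divr_ge0; [have := xi1 j; lra|exact: ltW].
have gM j : (g j < M)%N.
  have : (xi j + 1) / h <= M%:R - 1.
    by rewrite ler_pdivrMr// Mh; have := xi1 j; lra.
  rewrite -(ltr_nat R) => le1; rewrite (@le_lt_trans _ _ ((xi j + 1) / h))//; last lra.
  by rewrite Num.Theory.truncn_le.
pose y (j : nat) := tpast R M (g j).
have yxi j : y j <= xi j < y j + h.
  have := truncn_itv (xj j); rewrite -/(g j) => /andP[].
  rewrite ler_pdivlMr// ltr_pdivrMr// -natr1 mulrDl mul1r.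
  by rewrite /y /tpast -/h => *; lra.
have y1 j : -1 <= y j <= 1.
  have := yxi j; have := xi1 j.
  have : 0 <= (g j)%:R * h by rewrite mulr_ge0// ltW.
  have : y j = -1 + (g j)%:R * h by [].
  lra.
have Txi j : (j <= Rk)%N -> (cheb R Rk).[xi j] = (-1) ^+ j.
  move=> jR; rewrite cheb_cos; have [R0|R0] := posnP Rk.
    by move: jR; rewrite R0 leqn0 => /eqP ->; rewrite mul0r cos0.
  have -> : Rk%:R * (j%:R * (pi / Rk%:R)) = j%:R * pi :> R.
    by field; rewrite pnatr_eq0 -lt0n.
  elim: j {jR} => [|j ih]; first by rewrite mul0r cos0.
  by rewrite -natr1 mulrDl mul1r cosDpi ih exprS mulN1r.
have Ty j : (j <= Rk)%N -> 2^-1 <= (-1) ^+ j * (cheb R Rk).[y j].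
  move=> jR; have := @cheb_lip R Rk (y j) (xi j) (y1 j).
  move=> /(_ (xi1 j)); rewrite Txi//.
  have d1 : `|y j - xi j| <= h.
    by rewrite ler_norml; have := yxi j; lra.
  move=> /le_trans/(_ (ler_wpM2l (sqr_ge0 _) d1))/le_trans/(_ Rh).
  have -> : `|(cheb R Rk).[y j] - (-1) ^+ j| = `|(-1) ^+ j * (cheb R Rk).[y j] - 1|.
    have -> : (-1) ^+ j * (cheb R Rk).[y j] - 1 =
        (-1) ^+ j * ((cheb R Rk).[y j] - (-1) ^+ j).
      by rewrite mulrBr -expr2 sqrr_sign.
    by rewrite normrM normrX normrN1 expr1n mul1r.
  by rewrite ler_norml; lra.
(* Rounding is monotone, so only equality must be excluded; by [Ty] consecutive nodes carry
   Chebyshev values of opposite sign. *)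
have ydec j : (j < Rk)%N -> y j.+1 < y j.
  move=> jR; rewrite lt_neqAle; apply/andP; split.
    apply/eqP => yE; have := Ty _ jR; have := Ty _ (ltnW jR).
    by rewrite yE exprS mulN1r mulNr; lra.
  rewrite /y /tpast -/h lerD2l ler_pM2r// ler_nat /g.
  apply: le_truncn; rewrite ler_pM2r ?invr_gt0// lerD2r.
  have R0 : 0 < Rk%:R :> R by rewrite ltr0n (leq_ltn_trans _ jR).
  have inpi k : (k <= Rk)%N -> k%:R * (pi / Rk%:R) \in (`[0, (pi : R)])%R.
    move=> kR; rewrite in_itv/= mulr_ge0 ?divr_ge0 ?pi_ge0//=.
    by rewrite mulrCA ger_pMr ?pi_gt0// ler_pdivrMr// mul1r ler_nat.
  apply/ltW; rewrite /xi ltr_cos ?inpi//; last exact: ltnW.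
  by rewrite ltr_pM2r ?divr_gt0 ?pi_gt0// ltr_nat.
(* Prolongs the nodes, below -1, to a strictly decreasing sequence on [nat] as [lagrange_eval]
   requires. *)
pose x (j : nat) := if (j <= Rk)%N then y j else - 1 - j%:R.
have xdec : {homo x : i j / (i < j)%N >-> j < i}.
  apply: homo_ltn => [a b c ab bc|j]; first exact: lt_trans bc ab.
  rewrite /x; case: (ltnP j Rk) => [jR|Rj]; first by rewrite ltnW// ydec.
  have [jR|_] := leqP j Rk; last by rewrite -natr1; lra.
  by have := y1 j; have := ltr0Sn R j; lra.
have xt (j : 'I_Rk.+1) : x j < t.
  rewrite /x -ltnS ltn_ord; have := y1 j; rewrite /t /tnext -/h; lra.
pose l (k : 'I_Rk.+1) := (\prod_(j < Rk.+1 | j != k) (t - x j)) /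
  \prod_(j < Rk.+1 | j != k) (x k - x j).
have xy (k : 'I_Rk.+1) : x k = y k by rewrite /x -ltnS ltn_ord.
pose gi (k : 'I_Rk.+1) := Ordinal (gM k).
(* The Lagrange weights are collected over the fibres of [gi], so sums over the grid regroup into
   sums over the nodes. *)
exists (fun i => \sum_(k | gi k == i) l k); split.
- move=> p sp; rewrite (lagrange_eval t xdec sp).
  under eq_bigr do rewrite mulr_suml.
  rewrite (exchange_big_dep xpredT)//=; apply: eq_bigr => k _.
  rewrite (eq_bigl (pred1 (gi k))) => [|i]; last by rewrite /= eq_sym.
  by rewrite big_pred1_eq mulrC; congr (_ * _); rewrite xy.
- apply: (@le_trans _ _ (\sum_k `|l k|)).
    apply: (@le_trans _ _ (\sum_i \sum_(k | gi k == i) `|l k|)).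
      by apply: ler_sum => i _; exact: ler_norm_sum.
    rewrite (exchange_big_dep xpredT)//=; apply: ler_sum => k _.
    rewrite (eq_bigl (pred1 (gi k))) => [|i]; last by rewrite /= eq_sym.
    by rewrite big_pred1_eq.
  have t1 : 1 <= t by rewrite /t /tnext -/h; lra.
  (* Signs of weights and of node values alternate together, so the Chebyshev value at [t] is a sum
     of positive terms, each at least half of the modulus of its weight. *)
  rewrite -ler_pdivrMl// (le_trans _ (cheb_le Rk t1))//.
  rewrite (lagrange_eval t xdec (size_cheb R Rk)) mulr_sumr.
  apply: ler_sum => k _; rewrite -/(l k) xy.
  have lk := lagrange_sign k xdec xt; rewrite -/(l k) in lk.
  have -> : `|l k| = (-1) ^+ k * l k.
    by rewrite -[RHS]gtr0_norm// (normrM ((-1) ^+ k)) normrX normrN1 expr1n mul1r.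
  have -> : (cheb R Rk).[y k] * l k =
      ((-1) ^+ k * (cheb R Rk).[y k]) * ((-1) ^+ k * l k).
    by rewrite mulrACA -expr2 sqrr_sign mul1r.
  by apply: ler_wpM2r; [exact: ltW|apply: Ty; rewrite -ltnS].
Qed.

End Extrapolation.

(** * Euclidean and spectral norms *)

Section VectorNorm.
Variable R : realType.
Local Notation C := R[i].
Local Notation nc := (@ComplexField.Normc.normc R).

Lemma vnorm_ge0 n (v : 'cV[C]_n) : 0 <= vnorm v.
Proof. exact: sqrtr_ge0. Qed.

Lemma vnorm_sqr n (v : 'cV[C]_n) : vnorm v ^+ 2 = \sum_k nc (v k ord0) ^+ 2.
Proof.
rewrite /vnorm sqr_sqrtr; last by apply: sumr_ge0 => k _; rewrite addr_ge0 ?sqr_ge0.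
by apply: eq_bigr => k _; rewrite nc_sqr.
Qed.

Lemma vnorm_le n (v : 'cV[C]_n) (B : R) : 0 <= B ->
  \sum_k nc (v k ord0) ^+ 2 <= B ^+ 2 -> vnorm v <= B.
Proof. by move=> B0; rewrite -vnorm_sqr ler_sqr ?nnegrE ?vnorm_ge0. Qed.

Lemma coord_vnorm n (v : 'cV[C]_n) k : nc (v k ord0) <= vnorm v.
Proof.
rewrite -ler_sqr ?nnegrE ?vnorm_ge0 ?nc_ge0// vnorm_sqr (bigD1 k)//= lerDl.
by apply: sumr_ge0 => j _; rewrite sqr_ge0.
Qed.

Lemma vnorm_eq0 n (v : 'cV[C]_n) : vnorm v = 0 -> v = 0.
Proof.
move=> v0; apply/matrixP => k j; rewrite ord1 mxE; apply/eqP; rewrite -nc_eq0.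
by rewrite eq_le nc_ge0 andbT -v0 coord_vnorm.
Qed.

Lemma vnormZ n (a : R) (v : 'cV[C]_n) : vnorm (a%:C%C *: v) = `|a| * vnorm v.
Proof.
apply/eqP; rewrite -(eqrXn2 (n := 2)) ?mulr_ge0 ?vnorm_ge0//; apply/eqP.
rewrite exprMn !vnorm_sqr mulr_sumr; apply: eq_bigr => k _.
by rewrite mxE ncM nc_real exprMn.
Qed.

Lemma vnormN n (v : 'cV[C]_n) : vnorm (- v) = vnorm v.
Proof.
by rewrite /vnorm; congr Num.sqrt; apply: eq_bigr => k _; rewrite -!nc_sqr mxE ncN.
Qed.

Lemma vnorm0 n : vnorm (0 : 'cV[C]_n) = 0.
Proof. by have := vnormZ 0 (0 : 'cV[C]_n); rewrite scaler0 normr0 mul0r. Qed.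

Lemma vnorm_le_sum n (v : 'cV[C]_n) (B : 'I_n -> R) :
  (forall k, nc (v k ord0) <= B k) -> vnorm v <= \sum_k B k.
Proof.
move=> vB; have B0 k : 0 <= B k by rewrite (le_trans (nc_ge0 _) (vB k)).
apply: vnorm_le; first exact: sumr_ge0.
rewrite expr2 mulr_suml; apply: ler_sum => k _.
rewrite expr2 ler_pM ?nc_ge0// (le_trans (vB k))// (bigD1 k)//= lerDl.
exact: sumr_ge0.
Qed.

(** The supremum is usable because the sum of the moduli of all entries bounds the set; a nonzero
    [v] is then normalized. *)
Lemma specnormP m n (A : 'M[C]_(m, n)) (v : 'cV[C]_n) :
  vnorm (A *m v) <= specnorm A * vnorm v.
Proof.
have ub : has_ubound [set vnorm (A *m v) | v in [set v : 'cV[C]_n | vnorm v <= 1]].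
  exists (\sum_i \sum_j nc (A i j)) => _ [w /= w1 <-].
  apply: vnorm_le_sum => i; rewrite mxE (le_trans (nc_sum _ _ _))//.
  apply: ler_sum => j _; rewrite ncM ler_piMr ?nc_ge0//.
  exact: le_trans (coord_vnorm _ _) w1.
have [v0|v0] := eqVneq (vnorm v) 0.
  by rewrite (vnorm_eq0 v0) mulmx0 !vnorm0 mulr0.
have vp : 0 < vnorm v by rewrite lt_def v0 vnorm_ge0.
rewrite -ler_pdivrMr//; apply: (ub_le_sup ub).
exists (((vnorm v)^-1)%:C%C *: v) => /=.
  by rewrite vnormZ ger0_norm ?invr_ge0 ?vnorm_ge0// mulVf.
by rewrite -scalemxAr vnormZ ger0_norm ?invr_ge0 ?vnorm_ge0// mulrC.
Qed.

Lemma specnorm_ge0 m n (A : 'M[C]_(m, n)) : (0 < n)%N -> 0 <= specnorm A.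
Proof.
case: n A => // n A _; pose v : 'cV[C]_n.+1 := const_mx 1.
have v0 : 0 < vnorm v.
  by rewrite (lt_le_trans _ (coord_vnorm v ord0))// mxE nc1.
by rewrite -(pmulr_lge0 _ v0) (le_trans _ (specnormP A v))// vnorm_ge0.
Qed.

(** Termwise weighted arithmetic-geometric mean, [2 p q <= p ^+ 2 * (X / E) + q ^+ 2 * (E / X)],
    whose right-hand sides sum to [2 * E * X]. *)
Lemma cauchy_schwarz n (e x : 'cV[C]_n) :
  nc (\sum_k (e k ord0)^*%C * x k ord0) <= vnorm e * vnorm x.
Proof.
have [e0|e0] := eqVneq (vnorm e) 0.
  rewrite big1 ?nc0 ?mulr_ge0 ?vnorm_ge0// => k _.
  by rewrite (vnorm_eq0 e0) mxE conjc0 mul0r.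
have [x0|x0] := eqVneq (vnorm x) 0.
  rewrite big1 ?nc0 ?mulr_ge0 ?vnorm_ge0// => k _.
  by rewrite (vnorm_eq0 x0) mxE mulr0.
have ep : 0 < vnorm e by rewrite lt_def e0 vnorm_ge0.
have xp : 0 < vnorm x by rewrite lt_def x0 vnorm_ge0.
apply: (le_trans (nc_sum _ _ _)).
set E := vnorm e in ep *; set X := vnorm x in xp *.
have -> : E * X = \sum_k (nc (e k ord0) ^+ 2 * (X / E) + nc (x k ord0) ^+ 2 * (E / X)) / 2.
  rewrite -mulr_suml big_split/= -!mulr_suml -!vnorm_sqr -/E -/X.
  by field; rewrite !gt_eqF.
apply: ler_sum => k _; rewrite ncM.
have -> : nc (e k ord0)^*%C = nc (e k ord0) by case: (e k ord0) => a b /=; rewrite sqrrN.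
set p := nc _; set q := nc _; rewrite ler_pdivlMr// -subr_ge0.
have -> : p ^+ 2 * (X / E) + q ^+ 2 * (E / X) - p * q * 2 = (p * X - q * E) ^+ 2 / (E * X).
  by field; rewrite !gt_eqF.
by rewrite divr_ge0 ?sqr_ge0// mulr_ge0// ltW.
Qed.

Lemma vnorm_self n (e : 'cV[C]_n) :
  \sum_k (e k ord0)^*%C * e k ord0 = (vnorm e ^+ 2)%:C%C.
Proof.
rewrite vnorm_sqr rmorph_sum; apply: eq_bigr => k _; rewrite nc_sqr.
case: (e k ord0) => a b /=; apply/eqP; rewrite eq_complex/=.
by apply/andP; split; apply/eqP; ring.
Qed.

End VectorNorm.

(** * Regularity of the solution curve and boundedness on the ellipse *)

Section SolutionCurve.
Variable R : realType.
Local Notation C := R[i].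
Local Notation nc := (@ComplexField.Normc.normc R).

Section PolynomialClosure.
Variable P : (C -> C) -> Prop.
Hypothesis Pc : forall c, P (fun=> c).
Hypothesis Pa : forall f g, P f -> P g -> P (fun w => f w + g w).
Hypothesis Pm : forall f g, P f -> P g -> P (fun w => f w * g w).

(** [P] will be derivability at a point, or convergence along a filter. Both respect ring
    operations, hence determinants and adjugates, and one argument covers both. *)
Lemma fun_closed_sum (I : Type) (s : seq I) (Q : pred I) (F : I -> C -> C) :
  (forall i, P (F i)) -> P (fun w => \sum_(i <- s | Q i) F i w).
Proof.
move=> PF; elim: s => [|i s ih].
  by rewrite (_ : (fun _ => _) = fun=> 0) //; apply/funext => w; rewrite big_nil.
rewrite (_ : (fun _ => _) = fun w => (if Q i then F i w else 0) +
    \sum_(j <- s | Q j) F j w).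
  by apply: Pa => //; case: (Q i).
by apply/funext => w; rewrite big_cons; case: (Q i); rewrite ?add0r.
Qed.

Lemma fun_closed_prod (I : Type) (s : seq I) (Q : pred I) (F : I -> C -> C) :
  (forall i, P (F i)) -> P (fun w => \prod_(i <- s | Q i) F i w).
Proof.
move=> PF; elim: s => [|i s ih].
  by rewrite (_ : (fun _ => _) = fun=> 1) //; apply/funext => w; rewrite big_nil.
rewrite (_ : (fun _ => _) = fun w => (if Q i then F i w else 1) *
    \prod_(j <- s | Q j) F j w).
  by apply: Pm => //; case: (Q i).
by apply/funext => w; rewrite big_cons; case: (Q i); rewrite ?mul1r.
Qed.

Lemma fun_closed_det n (A : C -> 'M[C]_n) :
  (forall i j, P (fun w => A w i j)) -> P (fun w => \det (A w)).
Proof. by move=> PA; apply: fun_closed_sum => s; apply: Pm => //; exact: fun_closed_prod. Qed.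

Lemma fun_closed_adj n (A : C -> 'M[C]_n) i j :
  (forall i j, P (fun w => A w i j)) -> P (fun w => (\adj (A w)) i j).
Proof.
move=> PA; rewrite (_ : (fun _ => _) = fun w => cofactor (A w) j i); last first.
  by apply/funext => w; rewrite mxE.
apply: Pm => //; apply: (@fun_closed_det _ (fun w => row' j (col' i (A w)))) => k l.
rewrite (_ : (fun _ => _) = fun w => A w (lift j k) (lift i l))//.
by apply/funext => w; rewrite !mxE.
Qed.

(* Cramer's rule presents the solution through ring operations and one inverse. *)
Lemma fun_closed_solx n (A : C -> 'M[C]_n) (b : C -> 'cV[C]_n) k :
  (forall i j, P (fun w => A w i j)) -> (forall i, P (fun w => b w i ord0)) ->
  P (fun w => (\det (A w))^-1) ->
  P (fun w => ((\det (A w))^-1 *: (\adj (A w) *m b w)) k ord0).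
Proof.
move=> PA Pb Pd; rewrite (_ : (fun _ => _) = fun w => (\det (A w))^-1 *
    \sum_j (\adj (A w)) k j * b w j ord0); last first.
  by apply/funext => w; rewrite !mxE.
by apply: Pm => //; apply: fun_closed_sum => j; apply: Pm => //; exact: fun_closed_adj.
Qed.

End PolynomialClosure.

(** Unlike [invmx], this formula has no case distinction on invertibility. *)
Definition cramer n (A : C -> 'M[C]_n) (b : C -> 'cV[C]_n) (w : C) : 'cV[C]_n :=
  (\det (A w))^-1 *: (\adj (A w) *m b w).

Lemma solx_cramer n (A : C -> 'M[C]_n) b w :
  A w \in unitmx -> solx A b w = cramer A b w.
Proof. by move=> Aw; rewrite /solx /cramer /invmx Aw scalemxAl. Qed.

Lemma derivable_cramer n (A : C -> 'M[C]_n) (b : C -> 'cV[C]_n) z k :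
  derivable A z 1 -> derivable b z 1 -> A z \in unitmx ->
  derivable (fun w => cramer A b w k ord0) z 1.
Proof.
move=> dA db Az.
(* An opaque [P] keeps unification from unfolding the normed structure of [R[i]]. *)
have [P PE] : exists P : (C -> C) -> Prop, forall f, P f <-> derivable f z 1.
  by exists (fun f => derivable f z 1).
have Pc c : P (fun=> c) by apply/PE; exact: derivableC_cst.
have Pa f g : P f -> P g -> P (fun w => f w + g w).
  by move=> /PE hf /PE hg; apply/PE; exact: derivableC_add.
have Pm f g : P f -> P g -> P (fun w => f w * g w).
  by move=> /PE hf /PE hg; apply/PE; exact: derivableC_mul.
have PA i j : P (fun w => A w i j) by apply/PE; exact: derivable_coord.
have Pb i : P (fun w => b w i ord0) by apply/PE; exact: derivable_coord.
apply/PE; apply: (fun_closed_solx Pc Pa Pm k PA Pb); apply/PE; apply: derivableC_inv.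
  by move: Az; rewrite unitmxE unitfE.
by apply/PE; exact: (fun_closed_det Pc Pa Pm PA).
Qed.

Lemma continuous_cramer n (A : C -> 'M[C]_n) (b : C -> 'cV[C]_n) (D : set C) k :
  {within D, continuous A} -> {within D, continuous b} ->
  (forall w, D w -> A w \in unitmx) ->
  {within D, continuous (fun w => cramer A b w k ord0)}.
Proof.
move=> cA cb uA; apply/subspace_continuousP => z Dz.
have FF : Filter (within D (nbhs z)) by exact: within_filter (nbhs_filter z).
have [P PE] : exists P : (C -> C) -> Prop, forall f,
    P f <-> (f w @[w --> within D (nbhs z)] --> f z).
  by exists (fun f : C -> C => f w @[w --> within D (nbhs z)] --> f z).
have Pc c : P (fun=> c) by apply/PE; exact: (@cvg_cst C c _ _ FF).
have Pa f g : P f -> P g -> P (fun w => f w + g w).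
  by move=> /PE pf /PE pg; apply/PE; exact: (@cvgD C C _ _ FF f g _ _ pf pg).
have Pm f g : P f -> P g -> P (fun w => f w * g w).
  by move=> /PE pf /PE pg; apply/PE; exact: (@cvgM C _ _ FF f g _ _ pf pg).
have PA i j : P (fun w => A w i j).
  have /subspace_continuousP/(_ z Dz) h := cA.
  by apply/PE; exact: (cvg_comp _ _ h (@coord_continuous C _ _ i j (A z))).
have Pb i : P (fun w => b w i ord0).
  have /subspace_continuousP/(_ z Dz) h := cb.
  by apply/PE; exact: (cvg_comp _ _ h (@coord_continuous C _ _ i ord0 (b z))).
apply/PE; apply: (fun_closed_solx Pc Pa Pm k PA Pb); apply/PE.
have dz : \det (A z) != 0 by have := uA z Dz; rewrite unitmxE unitfE.
exact: (@cvgV C _ _ FF _ _ dz ((PE _).1 (fun_closed_det Pc Pa Pm PA))).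
Qed.

(** Divided by the semi-axes, the coordinates lie on the unit circle; the angle is the arc cosine of
    the first, signed by the second. *)
Lemma bern_boundary_param (L : R) (w : C) : 0 < L -> bern_boundary (expR L) w ->
  exists2 t, - pi <= t <= pi & w = jk (pol L t).
Proof.
move=> L0; case: w => X Y; rewrite /bern_boundary/= /bern_q/= => h.
have a0 := bern_a_gt0 L; have b0 := bern_b_gt0 L0.
rewrite -!expr_div_n in h; set x := X / _ in h; set y := Y / _ in h.
have x1 : -1 <= x <= 1 by have := sqr_ge0 y; nra.
have XE : X = bern_a (expR L) * x by rewrite /x mulrC divfK// gt_eqF.
have YE : Y = bern_b (expR L) * y by rewrite /y mulrC divfK// gt_eqF.
have acx : cos (acos x) = x by apply: acosK; rewrite in_itv.
have sx : sin (acos x) = `|y|.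
  by rewrite sin_acos// (_ : 1 - x ^+ 2 = y ^+ 2) ?sqrtr_sqr//; lra.
have t1 := acos_ge0 x1; have t2 := acos_lepi x1.
have [y0|y0] := leP 0 y.
  exists (acos x); first by rewrite t2 andbT; have := pi_ge0 R; lra.
  by rewrite jk_pol acx sx ger0_norm// XE YE.
exists (- acos x); first by have := pi_ge0 R; lra.
by rewrite jk_pol cosN sinN acx sx ltr0_norm// opprK XE YE.
Qed.

(** Continuity gives local bounds along the parametrized boundary, and [cousin2] in the angle alone
    joins them. *)
Lemma bounded_boundary (L : R) (f : C -> C) : 0 < L ->
  {within bern_closed (expR L), continuous f} ->
  exists B : R, forall w, bern_boundary (expR L) w -> nc (f w) <= B.
Proof.
move=> L0 cf; have pi0 := pi_ge0 R.
have LL : 0 <= L <= L by rewrite lexx ltW.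
have [|||B hB] := @cousin2 R (fun _ _ c d => exists B : R, forall t, c <= t <= d ->
    nc (f (jk (pol L t))) <= B) 0 0 (- pi) pi (lexx 0) _.
- lra.
- move=> a b c d m k [B1 h1] _ [B2 h2] _; exists (Num.max B1 B2) => t /andP[ct td].
  rewrite le_max; have [tk|kt] := leP t k; apply/orP.
    by left; apply: h1; rewrite ct.
  by right; apply: h2; rewrite ltW.
- move=> x t _ _.
  have [d d0 hd] := continuous_nc cf (bern_closed_jk t L0 LL) ltr01.
  have [d' d'0 hd'] := cdiff2_continuous
    (cdiff2_pol (derivable_jk (pol_neq0 L t))) d0.
  exists d' => // a b c e _ _ _ _ ht _ _ ce.
  exists (nc (f (jk (pol L t))) + 1) => t' ht'.
  have tt : `|t' - t| < d' by rewrite ltr_norml; lra.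
  have LL' : `|L - L| < d' by rewrite subrr normr0.
  have k1 := hd _ (bern_closed_jk t' L0 LL) (hd' _ _ LL' tt).
  have -> : f (jk (pol L t')) = f (jk (pol L t)) + (f (jk (pol L t')) - f (jk (pol L t))).
    by rewrite addrC subrK.
  by apply: (le_trans (ncD _ _)); rewrite lerD2l ltW.
exists B => w /(bern_boundary_param L0)[t ht ->]; exact: hB.
Qed.

End SolutionCurve.

(** * From the functional bound to the residual constants *)

Section Residual.
Variable R : realType.
Local Notation C := R[i].
Local Notation nc := (@ComplexField.Normc.normc R).

(** The supremum defining [kappa] is an upper bound because each Cramer coordinate is bounded on the
    boundary. *)
Lemma kappaP n (A : C -> 'M[C]_n) (b : C -> 'cV[C]_n) (L : R) : 0 < L ->
  {within bern_closed (expR L), continuous A} ->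
  {within bern_closed (expR L), continuous b} ->
  (forall t, bern_closed (expR L) t -> A t \in unitmx) ->
  forall w, bern_boundary (expR L) w -> vnorm (solx A b w) <= kappa A b (expR L).
Proof.
move=> L0 cA cb uA w hw; apply: ub_le_sup; last by exists w.
have bc z : bern_boundary (expR L) z -> bern_closed (expR L) z.
  by rewrite /bern_boundary /bern_closed/= => ->.
have [B hB] := choice (fun k : 'I_n =>
  bounded_boundary L0 (continuous_cramer (k := k) cA cb uA)).
exists (\sum_k B k) => _ [z hz <-].
by rewrite solx_cramer ?uA//; [apply: vnorm_le_sum => k; exact: hB|exact: bc].
Qed.

Lemma derivable_lincomb n (a : 'I_n -> C) (g : 'I_n -> C -> C) z :
  (forall k, derivable (g k) z 1) -> derivable (fun w => \sum_k a k * g k w) z 1.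
Proof.
move=> dg.
have [P PE] : exists P : (C -> C) -> Prop, forall f, P f <-> derivable f z 1.
  by exists (fun f => derivable f z 1).
have Pc c : P (fun=> c) by apply/PE; exact: derivableC_cst.
have Pa f h : P f -> P h -> P (fun w => f w + h w).
  by move=> /PE hf /PE hh; apply/PE; exact: derivableC_add.
apply/PE; apply: (fun_closed_sum Pc Pa) => k; apply/PE.
by apply: derivableC_mul; [exact: derivableC_cst|exact: dg].
Qed.

Lemma continuous_lincomb n (a : 'I_n -> C) (g : 'I_n -> C -> C) (D : set C) :
  (forall k, {within D, continuous (g k)}) ->
  {within D, continuous (fun w => \sum_k a k * g k w)}.
Proof.
move=> cg; apply/subspace_continuousP => z Dz.
have FF : Filter (within D (nbhs z)) by exact: within_filter (nbhs_filter z).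
have [P PE] : exists P : (C -> C) -> Prop, forall f,
    P f <-> (f w @[w --> within D (nbhs z)] --> f z).
  by exists (fun f : C -> C => f w @[w --> within D (nbhs z)] --> f z).
have Pc c : P (fun=> c) by apply/PE; exact: (@cvg_cst C c _ _ FF).
have Pa f h : P f -> P h -> P (fun w => f w + h w).
  by move=> /PE pf /PE ph; apply/PE; exact: (@cvgD C C _ _ FF f h _ _ pf ph).
apply/PE; apply: (fun_closed_sum Pc Pa) => k.
have /subspace_continuousP/(_ z Dz) gk := cg k.
by apply/PE; exact: (@cvgM C _ _ FF _ (g k) _ _ ((PE _).1 (Pc (a k))) gk).
Qed.

(** Duality reduces to a scalar function. Pairing the curve with the error vector [e] gives [f],
    bounded by [vnorm e * kappa]; the functional applied to [f] equals [vnorm e ^+ 2], and one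
    factor [vnorm e] cancels when it is nonzero. *)
Lemma extrapolation_error n (A : C -> 'M[C]_n) (b : C -> 'cV[C]_n) (L : R) (J : finType)
    (c : J -> C) (s t : J -> R) m :
  0 < L -> (0 < m)%N ->
  {within bern_closed (expR L), continuous A} ->
  {within bern_closed (expR L), continuous b} ->
  (forall z, bern_open (expR L) z -> derivable A z 1) ->
  (forall z, bern_open (expR L) z -> derivable b z 1) ->
  (forall t, bern_closed (expR L) t -> A t \in unitmx) ->
  (forall j, 0 <= s j < L) ->
  (forall k, (k < m)%N ->
     \sum_j c j * (pol (s j) (t j) ^+ k + (pol (s j) (t j))^-1 ^+ k) = 0) ->
  vnorm (\sum_j c j *: solx A b (jk (pol (s j) (t j)))) <=
  kappa A b (expR L) *
    \sum_j nc (c j) * (expR (s j - L) ^+ m / (1 - expR (s j - L))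
                        + expR (- s j - L) ^+ m / (1 - expR (- s j - L))).
Proof.
move=> L0 m0 cA cb dA db uA sL orth.
have kP := kappaP L0 cA cb uA.
have k0 : 0 <= kappa A b (expR L).
  exact: le_trans (vnorm_ge0 _) (kP _ (bern_boundary_jk 0 L0)).
set S := \sum_j nc _ * _.
have e1 j (z : R) : z <= s j -> 0 <= expR (z - L) ^+ m / (1 - expR (z - L)).
  move=> zs; rewrite divr_ge0 ?exprn_ge0 ?expR_ge0// subr_ge0 -expR0 ler_expR.
  by have := sL j; lra.
have S0 : 0 <= S.
  apply: sumr_ge0 => j _; rewrite mulr_ge0 ?nc_ge0// addr_ge0// (@e1 j)//.
  by have := sL j; lra.
set e := \sum_j _ *: _.
have [->|en0] := eqVneq (vnorm e) 0; first by rewrite mulr_ge0.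
have ep : 0 < vnorm e by rewrite lt_def en0 vnorm_ge0.
pose f w := \sum_k (e k ord0)^*%C * cramer A b w k ord0.
have oc := @bern_open_closed R (expR L).
have fC : {within bern_closed (expR L), continuous f}.
  by apply: continuous_lincomb => k; exact: continuous_cramer.
have fD z : bern_open (expR L) z -> derivable f z 1.
  move=> zo; apply: derivable_lincomb => k.
  by apply: derivable_cramer; [exact: dA|exact: db|exact/uA/oc].
have fk w : bern_boundary (expR L) w -> nc (f w) <= vnorm e * kappa A b (expR L).
  move=> hw; have wc : bern_closed (expR L) w.
    by move: hw; rewrite /bern_boundary /bern_closed/= => ->.
  apply: (le_trans (cauchy_schwarz _ _)); rewrite -solx_cramer ?uA//.
  by rewrite ler_wpM2l ?vnorm_ge0 ?kP.
have := functional_bound L0 fC fD m0 sL orth fk; rewrite -/S.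
have -> : \sum_j c j * f (jk (pol (s j) (t j))) = (vnorm e ^+ 2)%:C%C.
  rewrite -vnorm_self /f; under eq_bigr do rewrite mulr_sumr.
  rewrite exchange_big; apply: eq_bigr => k _ /=.
  rewrite [in RHS]/e summxE mulr_sumr; apply: eq_bigr => j _.
  have wc : bern_closed (expR L) (jk (pol (s j) (t j))).
    by apply: bern_closed_jk => //; have /andP[-> /ltW->] := sL j.
  rewrite mulrCA -(solx_cramer b (uA _ wc)); congr (_ * _).
  by rewrite [RHS]mxE.
by rewrite nc_real ger0_norm ?sqr_ge0// expr2 -mulrA ler_pM2l.
Qed.

(** The constant is at least 5/2 because [2 * (M - 1) <= 4 * M], and the radical is at most
    [tau]. *)
Lemma CMR_ge M Rk : (2 <= M)%N -> forall tau : R, 1 <= tau ->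
  2 * Num.sqrt (tau ^+ 2 - 1) <= CMR R M Rk * tau.
Proof.
move=> M2 tau tau1.
have M1 : 0 < M%:R - 1 :> R by rewrite subr_gt0 ltr1n.
have h1 : Num.sqrt (tau ^+ 2 - 1) <= tau.
  rewrite -[leRHS]ger0_norm; last by lra.
  rewrite -sqrtr_sqr; apply: ler_wsqrtr; lra.
have s5 : 1 <= Num.sqrt 5 :> R by rewrite -[leLHS]sqrtr1; apply: ler_wsqrtr; lra.
have sR : 1 <= Num.sqrt (2 * Rk%:R + 1) :> R.
  by rewrite -[leLHS]sqrtr1; apply: ler_wsqrtr; rewrite lerDr mulr_ge0.
have q0 : 0 < Num.sqrt (2 * (M%:R - 1)) :> R by rewrite sqrtr_gt0 mulr_gt0.
have qM : Num.sqrt (2 * (M%:R - 1)) <= 2 * Num.sqrt M%:R :> R.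
  rewrite -ler_sqr ?nnegrE ?mulr_ge0 ?sqrtr_ge0// exprMn !sqr_sqrtr//; [nra|].
  by rewrite mulr_ge0// ltW.
have m0 : 0 <= Num.sqrt M%:R :> R by exact: sqrtr_ge0.
have C2 : 2 <= CMR R M Rk.
  rewrite /CMR ler_pdivlMr//.
  have k1 : 1 <= Num.sqrt 5 * Num.sqrt (2 * Rk%:R + 1) :> R.
    by rewrite mulr_ege1.
  have -> : 5 * Num.sqrt 5 * Num.sqrt (2 * Rk%:R + 1) * Num.sqrt M%:R =
    5 * ((Num.sqrt 5 * Num.sqrt (2 * Rk%:R + 1)) * Num.sqrt M%:R) :> R by ring.
  have : Num.sqrt M%:R <= (Num.sqrt 5 * Num.sqrt (2 * Rk%:R + 1)) * Num.sqrt M%:R :> R.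
    by rewrite ler_peMl.
  lra.
nra.
Qed.

(** [g x] is the geometric tail of ratio [x] from degree [Rk.+1]. The extrapolation time has
    coefficient 1 and ratios [r] and [p]; the snapshots have total weight [c] and both ratios
    [rho^-1]. *)
Lemma tail_bound M Rk (tau rho p c : R) :
  let r := tau / rho in let g x := x ^+ Rk.+1 / (1 - x) in
  (2 <= M)%N -> 1 < tau -> tau < rho -> 0 <= p <= r -> 0 <= c ->
  c <= 2 * tau ^+ Rk ->
  1 * (g r + g p) + c * (g rho^-1 + g rho^-1) <=
  2 * (((1 - r)^-1
        + CMR R M Rk * rho / ((rho - 1) * Num.sqrt (rho ^+ 2 * r ^+ 2 - 1)))
       * r ^+ Rk.+1).
Proof.
move=> r g M2 tau1 taur /andP[p0 pr] c0 cle.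
have rho0 : 0 < rho by lra.
have rho1 : 0 < rho - 1 by lra.
have CM := CMR_ge Rk M2 (ltW tau1).
have rhor : rho * r = tau by rewrite /r mulrC divfK// gt_eqF.
have r1 : r < 1 by rewrite /r ltr_pdivrMr// mul1r.
(* As [rho * r] is [tau], the radical becomes [Num.sqrt (tau ^+ 2 - 1)]. *)
rewrite -exprMn rhor.
have sq0 : 0 < Num.sqrt (tau ^+ 2 - 1) by rewrite sqrtr_gt0; nra.
move: (Num.sqrt _) sq0 CM => sq sq0 CM.
pose q := rho^-1.
have q0 : 0 < q by rewrite invr_gt0.
have q1 : q < 1 by rewrite invf_lt1//; lra.
have gqE : g q = q ^+ Rk.+1 * rho / (rho - 1).
  by rewrite /g /q; field; rewrite !gt_eqF.
have gq0 : 0 <= g q by rewrite gqE divr_ge0 ?mulr_ge0 ?exprn_ge0// ltW.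
have gp : g p <= g r.
  apply: ler_pM; rewrite ?exprn_ge0 ?invr_ge0//.
  - by lra.
  - by rewrite lerXn2r ?nnegrE// (le_trans p0).
  - by rewrite lef_pV2 ?posrE; lra.
have B1 : 1 * (g r + g p) + c * (g q + g q) <= 2 * g r + 2 * tau ^+ Rk * (2 * g q).
  have : c * (g q + g q) <= 2 * tau ^+ Rk * (g q + g q).
    by rewrite ler_wpM2r// addr_ge0.
  lra.
apply: (le_trans B1); set P := r ^+ Rk.+1 ; set V := CMR R M Rk * _ / _.
have -> : 2 * (((1 - r)^-1 + V) * P) = 2 * ((1 - r)^-1 * P) + 2 * (V * P) by ring.
apply: lerD.
  by rewrite /g -/P [P / _]mulrC.
rewrite /V /P.
(* Substituting [r = tau * q] isolates the factor [CMR R M Rk * tau / sq], which is at least 2 by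
   [CMR_ge]. *)
have -> : 2 * (CMR R M Rk * rho / ((rho - 1) * sq) * r ^+ Rk.+1) =
  (2 * (q ^+ Rk.+1 * rho / (rho - 1)) * tau ^+ Rk) * (CMR R M Rk * tau / sq).
  rewrite (_ : r = tau * q)// exprMn [tau ^+ Rk.+1]exprS; field.
  by rewrite !gt_eqF.
rewrite -gqE.
have -> : 2 * tau ^+ Rk * (2 * g q) = 2 * g q * tau ^+ Rk * 2 by ring.
apply: ler_wpM2l; last by rewrite ler_pdivlMr.
have tau0 : 0 <= tau by lra.
by rewrite mulr_ge0 ?exprn_ge0// mulr_ge0.
Qed.

End Residual.

(** * The residual bound for the optimal initial guess *)

Theorem theorem2 (R : realType) (n M : nat) (rho : R)
  (A : R[i] -> 'M[R[i]]_n) (b : R[i] -> 'cV[R[i]]_n)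
  (s_star : 'cV[R[i]]_n) (Rk : nat) :
  (1 <= n)%N ->
  1 < rho ->
  {within bern_closed rho, continuous A} ->
  {within bern_closed rho, continuous b} ->
  (forall z, bern_open rho z -> derivable A z 1) ->
  (forall z, bern_open rho z -> derivable b z 1) ->
  (forall t, bern_closed rho t -> A t \in unitmx) ->
  (2 <= M)%N ->
  (* s_star lies in S = span(X) and minimizes the residual at t_i over S *)
  (exists c : 'cV[R[i]]_M, s_star = snapX M A b *m c) ->
  (forall c : 'cV[R[i]]_M,
      vnorm (A (cplx (tnext R M)) *m s_star - b (cplx (tnext R M)))
      <= vnorm (A (cplx (tnext R M)) *m (snapX M A b *m c)
                - b (cplx (tnext R M)))) ->
  let ti := tnext R M in
  let r := (ti + Num.sqrt (ti ^+ 2 - 1)) / rho in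
  r < 1 ->
  (Rk%:R : R) <= Num.sqrt (M%:R - 1) / 2 ->
  vnorm (A (cplx ti) *m s_star - b (cplx ti))
  <= 2 * specnorm (A (cplx ti)) * kappa A b rho
     * ((1 - r)^-1
        + CMR R M Rk * rho / ((rho - 1) * Num.sqrt (rho ^+ 2 * r ^+ 2 - 1)))
     * r ^+ Rk.+1.
Proof.
move=> n1 rho1 cA cb dA db uA M2 _ opt ti r r1 hR.
have rho0 : 0 < rho by lra.
pose L := ln rho.
have rhoE : rho = expR L by rewrite /L lnK// posrE.
have L0 : 0 < L by rewrite ln_gt0.
(* The Joukowski preimage of [ti] outside the unit circle; [r < 1] places its level [s] below
   [L]. *)
pose tau := ti + Num.sqrt (ti ^+ 2 - 1).
have M1 : 0 < M%:R - 1 :> R by rewrite subr_gt0 ltr1n.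
have h0 : 0 < dt R M by rewrite divr_gt0.
have ti1 : 1 < ti by rewrite /ti /tnext; lra.
have st0 : 0 <= ti ^+ 2 - 1 by nra.
have st2 : Num.sqrt (ti ^+ 2 - 1) ^+ 2 = ti ^+ 2 - 1 by rewrite sqr_sqrtr.
have stp : 0 < Num.sqrt (ti ^+ 2 - 1) by rewrite sqrtr_gt0; nra.
have tau1 : 1 < tau by rewrite /tau; lra.
have tau0 : 0 < tau by lra.
have taun : tau != 0 by rewrite gt_eqF.
pose s := ln tau.
have tauE : tau = expR s by rewrite /s lnK// posrE.
have s0 : 0 <= s by rewrite ln_ge0// ltW.
have rE : r = expR (s - L) by rewrite expRD expRN -tauE -rhoE.
have sL : s < L by move: r1; rewrite rE -[ltRHS](@expR0 R) ltr_expR; lra.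
have jkt : jk (pol s 0) = cplx ti.
  rewrite jk_pol cos0 sin0 mulr1 mulr0 -tauE /bern_a; congr Complex.
  have -> : tau^-1 = ti - Num.sqrt (ti ^+ 2 - 1).
    apply: (mulfI taun); rewrite mulfV// /tau mulrC -subr_sqr st2; ring.
  by rewrite /tau; field.
have tp (j : 'I_M) : -1 <= tpast R M j <= 1.
  rewrite /tpast; have : 0 <= j%:R * dt R M by rewrite mulr_ge0// ltW.
  have : j%:R * dt R M <= (M%:R - 1) * dt R M.
    rewrite ler_pM2r// lerBrDr natr1 ler_nat; exact: ltn_ord.
  have -> : (M%:R - 1) * dt R M = 2 by rewrite /dt mulrC divfK// gt_eqF.
  lra.
have jkp (j : 'I_M) : jk (pol 0 (acos (tpast R M j))) = cplx (tpast R M j).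
  rewrite jk_pol expR0 /bern_a /bern_b invr1 subrr mul0r mul0r acosK ?in_itv//=.
  by congr Complex; rewrite divff// mul1r.
have [c [cp c1]] := extrap_coefs M2 hR.
(* Index 0 is the next time at level [s], with coefficient 1; the others are the snapshots, on the
   unit circle (level 0), with coefficients [- c k]. *)
pose cc (j : 'I_M.+1) : R[i] := if unlift ord0 j is Some k then - (c k)%:C%C else 1.
pose ss (j : 'I_M.+1) : R := if unlift ord0 j is Some k then 0 else s.
pose tt (j : 'I_M.+1) : R := if unlift ord0 j is Some k then acos (tpast R M k) else 0.
have recl (V : zmodType) (F : R[i] -> R -> R -> V) :
  \sum_j F (cc j) (ss j) (tt j) =
  F 1 s 0 + \sum_(k < M) F (- (c k)%:C%C) 0 (acos (tpast R M k)).
  rewrite big_ord_recl /cc /ss /tt unlift_none; congr (_ + _).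
  by apply: eq_bigr => k _; rewrite liftK.
have ssL j : 0 <= ss j < L.
  by rewrite /ss; case: (unlift ord0 j) => [k|]; rewrite ?lexx ?L0 ?s0.
have orth k : (k < Rk.+1)%N ->
    \sum_j cc j * (pol (ss j) (tt j) ^+ k + (pol (ss j) (tt j))^-1 ^+ k) = 0.
  (* By [cheb_jk] each bracket is twice a Chebyshev value, and [c] extrapolates polynomials of
     degree at most [Rk] exactly. *)
  move=> kR; rewrite (recl _ (fun a s t => a * (pol s t ^+ k + (pol s t)^-1 ^+ k))).
  have sk : (size (cheb R k) <= Rk.+1)%N by rewrite (leq_trans (size_cheb R k)).
  rewrite mul1r -(@cheb_jk R k ti) ?pol_neq0//.
  rewrite -(cp _ sk) rmorph_sum mulr_sumr -big_split big1// => j _ /=.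
  rewrite -(@cheb_jk R k (tpast R M j)) ?pol_neq0 ?jkp// rmorphM; ring.
rewrite rhoE in cA cb dA db uA.
have err := extrapolation_error L0 (ltn0Sn Rk) cA cb dA db uA ssL orth.
move: err.
rewrite (recl _ (fun a s t => a *: solx A b (jk (pol s t)))).
rewrite (recl _ (fun a s t => ComplexField.Normc.normc a *
                       (expR (s - L) ^+ Rk.+1 / (1 - expR (s - L))
                        + expR (- s - L) ^+ Rk.+1 / (1 - expR (- s - L))))).
rewrite scale1r jkt; set e := _ + _; set B := _ + _ => err.
pose c' : 'cV[R[i]]_M := \col_j (c j)%:C%C.
have eE : e = solx A b (cplx ti) - snapX M A b *m c'.
  congr (_ + _); apply/matrixP => k l; rewrite ord1 summxE !mxE -sumrN.
  by apply: eq_bigr => j _; rewrite jkp !mxE mulNr mulrC.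
have Au : A (cplx ti) \in unitmx.
  by apply: uA; rewrite -jkt; apply: bern_closed_jk => //; rewrite s0 ltW.
(* The extrapolant competes in the minimization; since [A x = b] at [ti], its residual is
   [- A e]. *)
apply: (le_trans (opt c')).
have -> : A (cplx ti) *m (snapX M A b *m c') - b (cplx ti) = - (A (cplx ti) *m e).
  by rewrite eE mulmxBr opprB /solx [A _ *m (invmx _ *m _)]mulmxA mulmxV// mul1mx.
rewrite vnormN; apply: (le_trans (specnormP _ _)).
set W := (1 - r)^-1 + _; set S := specnorm _; set K := kappa A b rho.
have -> : 2 * S * K * W * r ^+ Rk.+1 = S * (K * (2 * (W * r ^+ Rk.+1))) by ring.
apply: ler_wpM2l; first exact: specnorm_ge0.
apply: (le_trans err); rewrite -rhoE; apply: ler_wpM2l.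
  rewrite /K rhoE; apply: le_trans (kappaP L0 cA cb uA (bern_boundary_jk 0 L0)).
  exact: vnorm_ge0.
have taur : tau < rho by move: r1; rewrite ltr_pdivrMr// mul1r.
have pr : 0 <= expR (- s - L) <= r.
  by rewrite expR_ge0 rE ler_expR lerD2r /=; lra.
have c0 : 0 <= \sum_k `|c k| by exact: sumr_ge0.
apply: le_trans (tail_bound M2 tau1 taur pr c0 c1).
rewrite /B nc1 -rE oppr0 !sub0r expRN -rhoE -mulr_suml.
under eq_bigr do rewrite ncN nc_real.
exact: lexx.
Qed.
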